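(* Let $n\ge 0$ and assume that $\bar h^{n,C}_{ij}\ge 0$ and $\bar h^{n,D}_{ij}\ge 0$ for all $i,j$. Let the cell averages at the next time level be given by $$\begin{aligned} \bar h^{n+1,C}_{ij}={}&(1-\theta)\,\bar h^{n,C}_{ij}+\frac{\theta}{\Delta x\Delta y}\int_{C_{ij}}h^{n,D}\,dx\,dy\\ &-\frac{\Delta t_n}{\Delta x\Delta y}\int_{y_{j-\frac12}}^{y_{j+\frac12}}\Big[(h^{n,D}u^{n,D})(x_{i+\frac12},y)-(h^{n,D}u^{n,D})(x_{i-\frac12},y)\Big]dy\\ &-\frac{\Delta t_n}{\Delta x\Delta y}\int_{x_{i-\frac12}}^{x_{i+\frac12}}\Big[(h^{n,D}v^{n,D})(x,y_{j+\frac12})-(h^{n,D}v^{n,D})(x,y_{j-\frac12})\Big]dx\\ &+\theta\Big(\frac{1}{\Delta x\Delta y}\int_{C_{ij}}b^{D}\,dx\,dy-\bar b^{C}_{ij}\Big) \end{aligned}$$ and by the counterpart on the dual mesh $$\begin{aligned} \bar h^{n+1,D}_{ij}={}&(1-\theta)\,\bar h^{n,D}_{ij}+\frac{\theta}{\Delta x\Delta y}\int_{D_{ij}}h^{n,C}\,dx\,dy\\ &-\frac{\Delta t_n}{\Delta x\Delta y}\int_{y_{j-1}}^{y_{j}}\Big[(h^{n,C}u^{n,C})(x_{i},y)-(h^{n,C}u^{n,C})(x_{i-1},y)\Big]dy\\ &-\frac{\Delta t_n}{\Delta x\Delta y}\int_{x_{i-1}}^{x_{i}}\Big[(h^{n,C}v^{n,C})(x,y_{j})-(h^{n,C}v^{n,C})(x,y_{j-1})\Big]dx\\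 &+\theta\Big(\frac{1}{\Delta x\Delta y}\int_{D_{ij}}b^{C}\,dx\,dy-\bar b^{D}_{ij}\Big). \end{aligned}$$ If $$\bar b^{C}_{ij}=\frac{1}{\Delta x\Delta y}\int_{C_{ij}}b^{D}\,dx\,dy,\qquad \bar b^{D}_{ij}=\frac{1}{\Delta x\Delta y}\int_{D_{ij}}b^{C}\,dx\,dy\qquad\text{for all } i,j,$$ and $h^{n,C}(x,y)\ge 0$, $h^{n,D}(x,y)\ge 0$ for all $(x,y)\in L^{l,m}_{i,j}$, for all $i,j$ and $l,m\in\{1,2\}$, then $\bar h^{n+1,C}_{ij}\ge 0$ and $\bar h^{n+1,D}_{ij}\ge 0$ for all $i,j$, under the CFL condition $$\lambda_x a_x+\lambda_y a_y\le \tfrac14\,\theta\,\hat\omega_1,$$ where $\lambda_x=\Delta t_n/\Delta x$, $\lambda_y=\Delta t_n/\Delta y$, $a_x=\max(\|u^{n,C}\|_\infty,\|u^{n,D}\|_\infty)$ and $a_y=\max(\|v^{n,C}\|_\infty,\|v^{n,D}\|_\infty)$.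
   Context: **Meshes.** $\{x_i\}_i$ and $\{y_j\}_j$ are uniform partitions with spacings $\Delta x>0$, $\Delta y>0$. Put $x_{i+\frac12}=\frac12(x_i+x_{i+1})$, $y_{j+\frac12}=\frac12(y_j+y_{j+1})$. The primal cells are $C_{ij}=[x_{i-\frac12},x_{i+\frac12}]\times[y_{j-\frac12},y_{j+\frac12}]$ and the dual cells are $D_{ij}=[x_{i-1},x_i]\times[y_{j-1},y_j]$; the two meshes overlap. The data on all cells appearing in the formulas are assumed available (at the boundary of the domain they are supplied by boundary conditions and treated like the other cells). **Discrete functions.** Fix an integer $k\ge1$. $h^{n,C}$ (resp. $h^{n,D}$) is the water depth at time $t_n$, a piecewise polynomial of degree at most $k$ on each $C_{ij}$ (resp. $D_{ij}$), possibly discontinuous across cell boundaries. $u^{n,C},v^{n,C}$ (resp. $u^{n,D},v^{n,D}$) are the velocity components, which are continuous functions whose restriction to each $C_{ij}$ (resp. $D_{ij}$) is a polynomial of degree at most $k$. $b^C$ (resp. $b^D$) is an approximation of the bottom topography, a piecewise polynomial of degree at most $k$ on each $C_{ij}$ (resp. $D_{ij}$). $\bar h^{n,C}_{ij},\bar b^C_{ij}$ (resp. $\bar h^{n,D}_{ij},\bar b^D_{ij}$) are the averages of $h^{n,C},b^C$ over $C_{ij}$ (resp. of $h^{n,D},b^D$ over $D_{ij}$). $\Delta t_n>0$ is the time step, and $\theta=\Delta t_n/\tau\in[0,1]$, where $\tau>0$ is the maximal time step allowed by the scheme's CFL restriction. **Quadrature.** $\hat L_i^{1,x}$ and $\hat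 L_i^{2,x}$ are the sets of $\hat N$ Legendre Gauss–Lobatto points (endpoints included) on $[x_{i-\frac12},x_i]$ and $[x_i,x_{i+\frac12}]$; similarly $\hat L_j^{1,y}$ and $\hat L_j^{2,y}$ on $[y_{j-\frac12},y_j]$ and $[y_j,y_{j+\frac12}]$. The corresponding weights on $[-\frac12,\frac12]$ are $\hat\omega_\beta$, $\beta=1,\dots,\hat N$ (so they sum to 1; $\hat\omega_1$ is the endpoint weight), with $\hat N\geq 2$ chosen so that $2\hat N-3\ge k$. $L_i^{1,x}$, $L_i^{2,x}$, $L_j^{1,y}$, $L_j^{2,y}$ are the sets of $N$ Gauss(–Legendre) points on $[x_{i-\frac12},x_i]$, $[x_i,x_{i+\frac12}]$, $[y_{j-\frac12},y_j]$, $[y_j,y_{j+\frac12}]$ respectively, with $N$ chosen so that the rule is exact for univariate polynomials of degree $2k+1$. For $l,m\in\{1,2\}$, $$L^{l,m}_{i,j}=(L_i^{l,x}\times\hat L_j^{m,y})\cup(\hat L_i^{l,x}\times L_j^{m,y}).$$ These points lie in the closed quarter of $C_{ij}$ with $x$-half $l$ and $y$-half $m$. This quarter is contained in exactly one primal and one dual cell, and the values of $h^{n,C}$ and $h^{n,D}$ at points of $L^{l,m}_{i,j}$ are those of the polynomials on these cells (one-sided values from this quarter). *)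

(* Defs.v *)
From HB Require Import structures.
From mathcomp Require Import all_boot all_order all_algebra.
From mathcomp Require Import all_classical all_reals all_analysis.
From mathcomp Require polyrcf.

Set Implicit Arguments.
Unset Strict Implicit.
Unset Printing Implicit Defensive.

Import Order.TTheory GRing.Theory Num.Theory.
Import numFieldNormedType.Exports.

Local Open Scope classical_set_scope.
Local Open Scope ring_scope.

Section Quadrature.
Variable R : realType.

(* Rodrigues' formula. *)
Definition legendre (n : nat) : {poly R} :=
  ((2 ^ n * n`!)%:R)^-1 *: (('X^2 - 1) ^+ n)^`(n).

(* Nodes on the reference interval [-1, 1], in increasing order. *)
Definition gauss_nodes (n : nat) : seq R := polyrcf.rootsR (legendre n).

(* Meaningful for 2 <= n only. *)
Definition lobatto_nodes (n : nat) : seq R :=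
  -1 :: rcons (polyrcf.rootsR (legendre n.-1)^`()) 1.

Definition lagrange_basis (s : seq R) (b : nat) : {poly R} :=
  \prod_(c < size s | c != b :> nat) ((s`_b - s`_c)^-1 *: ('X - (s`_c)%:P)).

(* The factor 1/2 normalises the interpolatory weights on [-1, 1] to an
   interval of length 1, so that they sum to 1. *)
Definition quad_weight (s : seq R) (b : nat) : R :=
  2^-1 * \int[lebesgue_measure]_(t in `[-1, 1]) (lagrange_basis s b).[t].

Definition quad_exact (s : seq R) (d : nat) : Prop :=
  forall p : {poly R}, (size p <= d.+1)%N ->
    \sum_(b < size s) quad_weight s b * p.[s`_b] =
    2^-1 * \int[lebesgue_measure]_(t in `[-1, 1]) p.[t].

(* The weight called omega-hat_1, i.e. that of the left endpoint. *)
Definition lobatto_end_weight (n : nat) : R := quad_weight (lobatto_nodes n) 0.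

(* An interval [a, b] is represented by the pair (a, b). *)
Definition nodes_on (s : seq R) (I : R * R) : set R :=
  [set (I.1 + I.2) / 2 + (I.2 - I.1) / 2 * t | t in [set` s]].

Definition gauss_on (n : nat) (I : R * R) : set R :=
  nodes_on (gauss_nodes n) I.

Definition lobatto_on (n : nat) (I : R * R) : set R :=
  nodes_on (lobatto_nodes n) I.

End Quadrature.

Section Mesh.
Variable R : realType.

Definition uniform_partition (x : int -> R) (dx : R) : Prop :=
  0 < dx /\ forall i : int, x (i + 1) - x i = dx.

(* mid x i is x_{i+1/2}, hence mid x (i - 1) is x_{i-1/2}. *)
Definition mid (x : int -> R) (i : int) : R := (x i + x (i + 1)) / 2.

(* The one-dimensional factors of the primal cells C_ij and of the dual
   cells D_ij. *)
Definition primal (x : int -> R) (i : int) : R * R := (mid x (i - 1), mid x i).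
Definition dual (x : int -> R) (i : int) : R * R := (x (i - 1), x i).

(* The two halves of primal x i, l = false standing for the superscript 1 and
   l = true for 2.  Half l is contained in dual x (i + l). *)
Definition half (x : int -> R) (l : bool) (i : int) : R * R :=
  if l then (x i, mid x i) else (mid x (i - 1), x i).

Definition box (I J : R * R) : set (R * R) :=
  `[I.1, I.2] `*` `[J.1, J.2].

Definition region (cx cy : int -> R * R) (I : set (int * int)) : set (R * R) :=
  \bigcup_(q in I) box (cx q.1) (cy q.2).

Definition quad_points (N Nh : nat) (x y : int -> R) (l m : bool) (i j : int)
    : set (R * R) :=
  (gauss_on N (half x l i) `*` lobatto_on Nh (half y m j)) `|`
  (lobatto_on Nh (half x l i) `*` gauss_on N (half y m j)).

End Mesh.

Section DiscreteFunctions.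
Variable R : realType.

Definition total_degree_le (k : nat) (p : {poly {poly R}}) : Prop :=
  forall a b : nat, (k < a + b)%N -> p`_a`_b = 0.

Definition peval (p : {poly {poly R}}) (z : R * R) : R := p.[z.1%:P].[z.2].

(* A possibly discontinuous piecewise polynomial function is given by one
   polynomial per cell. *)
Definition pieces : Type := int -> int -> {poly {poly R}}.

Definition pieces_le (k : nat) (I : set (int * int)) (p : pieces) : Prop :=
  forall i j : int, I (i, j) -> total_degree_le k (p i j).

(* For a uniform family of adjacent intervals c: the i such that t belongs to
   c i with its right endpoint removed. *)
Definition cell_index (c : int -> R * R) (t : R) : int :=
  Num.floor ((t - (c 0).1) / ((c 0).2 - (c 0).1)).

(* On cell boundaries, a null set for every integral in which this function is
   used, the value is the trace from the right / from above. *)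
Definition pw (cx cy : int -> R * R) (p : pieces) (z : R * R) : R :=
  peval (p (cell_index cx z.1) (cell_index cy z.2)) z.

Definition cont_pw_poly (k : nat) (cx cy : int -> R * R) (I : set (int * int))
    (u : R * R -> R) : Prop :=
  {within region cx cy I, continuous u} /\
  forall i j : int, I (i, j) -> exists2 p : {poly {poly R}},
    total_degree_le k p & forall z, box (cx i) (cy j) z -> u z = peval p z.

(* Extended-real valued: +oo when u is unbounded on A. *)
Definition sup_norm (A : set (R * R)) (u : R * R -> R) : \bar R :=
  ereal_sup [set (`|u z|)%:E | z in A].

Definition box_int (I J : R * R) (f : R * R -> R) : R :=
  \int[(@lebesgue_measure R \x @lebesgue_measure R)%E]_(z in box I J) f z.

Definition box_avg (I J : R * R) (f : R * R -> R) : R :=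
  ((I.2 - I.1) * (J.2 - J.1))^-1 * box_int I J f.

(* The new average on the cell I x J of one mesh, whose current averages are
   hbar and bbar; h, u, v, b are the functions living on the other mesh. *)
Definition new_average (theta dt dx dy : R) (I J : R * R) (hbar bbar : R)
    (h u v b : R * R -> R) : R :=
  (1 - theta) * hbar
  + theta / (dx * dy) * box_int I J h
  - dt / (dx * dy) * (\int[lebesgue_measure]_(y in `[J.1, J.2])
      (h (I.2, y) * u (I.2, y) - h (I.1, y) * u (I.1, y)))
  - dt / (dx * dy) * (\int[lebesgue_measure]_(x in `[I.1, I.2])
      (h (x, J.2) * v (x, J.2) - h (x, J.1) * v (x, J.1)))
  + theta * ((dx * dy)^-1 * box_int I J b - bbar).

(* IC and ID are the sets of indices of the primal and dual cells on which
   data are available (ghost cells supplied by boundary conditions included;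
   setT for an unbounded mesh).  The two predicates below say that all cells occurring
   in the update formula of C_ij, resp. D_ij, are available. *)
Definition stencilC (IC ID : set (int * int)) (i j : int) : Prop :=
  IC (i, j) /\ forall l m : bool, ID (i + l%:Z, j + m%:Z).

Definition stencilD (IC ID : set (int * int)) (i j : int) : Prop :=
  ID (i, j) /\ forall l m : bool, IC (i - l%:Z, j - m%:Z).

End DiscreteFunctions.

(* Main.v *)
Require Import Defs.
From mathcomp Require Import all_boot all_order all_algebra.
From mathcomp Require Import all_classical all_reals all_analysis.
From mathcomp Require Import measurable_realfun ring lra zify.
From mathcomp Require polyrcf polyorder.

Import Order.TTheory GRing.Theory Num.Theory.
Import numFieldNormedType.Exports.

Local Open Scope classical_set_scope.
Local Open Scope ring_scope.

(* On each quarter of a cell the data of the other mesh are polynomials.  The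
   mean of h over a quarter is a nonnegative combination of values at the points
   of L^{l,m}, by the tensor product of the Gauss rule in one variable and the
   Gauss-Lobatto rule in the other; keeping only the Lobatto node on an outer
   edge bounds it below by omega_1 times the Gauss sum of h along that edge,
   and the same Gauss sum times |u| (or |v|) computes the flux through the edge
   exactly.  This works for the vertical and for the horizontal edge of the
   quarter, so the CFL condition makes theta times the mean absorb both fluxes
   already quarter by quarter.
   The weights of both rules are nonnegative, and the two end weights of the
   Lobatto rule agree, because the rules integrate exactly the squares (times
   1 - t, 1 + t or 1 - t^2) that isolate one node; that exactness follows from
   Rodrigues' formula: repeated integration by parts gives orthogonality and
   Rolle's theorem gives enough distinct roots in ]-1, 1[. *)

(** * Integrals of univariate polynomials through antiderivatives *)

Section PolynomialIntegral.
Context {R : realType}.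
Implicit Types (p q : {poly R}) (a b : R).

Definition antideriv p : {poly R} := \poly_(i < (size p).+1) (p`_i.-1 / i%:R).

Lemma deriv_antideriv p : (antideriv p)^`() = p.
Proof.
apply/polyP => i; rewrite coef_deriv coef_poly ltnS /=.
case: ltnP => [_|/leq_sizeP -> //]; last by rewrite mul0rn.
by rewrite -[LHS]mulr_natr divfK // pnatr_eq0.
Qed.

(** An algebraic integral, for which linearity, substitution and integration by parts need no
    integrability side conditions. [Rintegral_poly] ties it to the Lebesgue integral. *)
Definition pint a b p : R := (antideriv p).[b] - (antideriv p).[a].

(** Any antiderivative may replace the canonical one: their difference has zero derivative, hence is
    constant in characteristic zero. *)
Lemma pint_deriv a b p : pint a b p^`() = p.[b] - p.[a].
Proof.
have : (antideriv p^`() - p)^`() = 0 by rewrite derivB deriv_antideriv subrr.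
move=> /eqP; rewrite -size_poly_eq0 polyorder.size_deriv => sz.
have /size1_polyC E : (size (antideriv p^`() - p)%R <= 1)%N.
  by rewrite -subn_eq0 subn1.
have F t : (antideriv p^`()).[t] = p.[t] + (antideriv p^`() - p)`_0.
  by have := congr1 (horner^~ t) E; rewrite !hornerE => <-; ring.
by rewrite /pint !F; ring.
Qed.

Lemma pintD a b p q : pint a b (p + q) = pint a b p + pint a b q.
Proof.
rewrite -{1}(deriv_antideriv p) -{1}(deriv_antideriv q) -derivD pint_deriv.
by rewrite /pint !hornerD; ring.
Qed.

Lemma pintZ a b c p : pint a b (c *: p) = c * pint a b p.
Proof.
by rewrite -{1}(deriv_antideriv p) -derivZ pint_deriv /pint !hornerZ; ring.
Qed.

Lemma pint0 a b : pint a b 0 = 0.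
Proof. by rewrite -(scale0r 0) pintZ mul0r. Qed.

Lemma pintB a b p q : pint a b (p - q) = pint a b p - pint a b q.
Proof. by rewrite pintD -scaleN1r pintZ mulN1r. Qed.

Lemma pint_sum a b (I : Type) (r : seq I) (F : I -> {poly R}) :
  pint a b (\sum_(i <- r) F i) = \sum_(i <- r) pint a b (F i).
Proof. by apply: (big_morph _ (pintD a b) (pint0 a b)). Qed.

Lemma pint_ge0 a b p : a <= b -> (forall t, a < t < b -> 0 <= p.[t]) ->
  0 <= pint a b p.
Proof.
move=> ab p0; rewrite subr_ge0; apply: (@polyrcf.ler_hornerW _ a b) => //.
- by move=> t tab; rewrite deriv_antideriv p0 //; rewrite in_itv in tab.
- by rewrite in_itv /= lexx.
- by rewrite in_itv /= lexx ab.
Qed.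

(** The chain rule for [antideriv p] composed with the affine map; it carries rules on the reference
    interval over to any interval. *)
Lemma pint_affine a b p :
  pint a b p =
    (b - a) / 2 * pint (-1) 1 (p \Po (((a + b) / 2)%:P + ((b - a) / 2) *: 'X)).
Proof.
set l := _%:P + _; have dl : l^`() = ((b - a) / 2)%:P.
  by rewrite derivD derivC add0r derivZ derivX alg_polyC.
rewrite -pintZ -mul_polyC mulrC -dl -{2}(deriv_antideriv p) -deriv_comp pint_deriv.
rewrite !horner_comp /l !(hornerD, hornerZ, hornerC, hornerX) /pint.
by congr (_.[_] - _.[_]); field.
Qed.

Lemma pint_opp p : pint (-1) 1 (p \Po - 'X) = pint (-1) 1 p.
Proof.
have -> : p \Po - 'X = (- (antideriv p \Po - 'X))^`().
  by rewrite derivN deriv_comp deriv_antideriv derivN derivX mulrN1 opprK.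
by rewrite pint_deriv /pint !hornerN !horner_comp !hornerN !hornerX !opprK; ring.
Qed.

Lemma Rintegral_poly a b p : a <= b ->
  \int[lebesgue_measure]_(t in `[a, b]) p.[t] = pint a b p.
Proof.
(* The fundamental theorem of calculus requires [a < b]; on a single point both sides vanish. *)
rewrite le_eqVlt => /orP[/eqP <-|ab].
  by rewrite set_itv1 Rintegral_set1 /pint subrr.
have cont (q : {poly R}) : continuous (horner q) by apply: continuous_horner.
rewrite /Rintegral (@continuous_FTC2 _ (horner p) (horner (antideriv p)))//.
- by apply: continuous_subspaceT.
- split; first by move=> t _; apply: derivable_horner.
  + by apply: cvg_at_right_filter; exact: cont.
  + by apply: cvg_at_left_filter; exact: cont.
- by move=> t _; rewrite -derivE deriv_antideriv.
Qed.

Lemma integrable_poly a b p :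
  lebesgue_measure.-integrable `[a, b] (EFin \o horner p).
Proof.
apply: continuous_compact_integrable; first exact: segment_compact.
by apply: continuous_subspaceT; exact: continuous_horner.
Qed.

End PolynomialIntegral.

(** * Interpolatory quadrature rules *)

Section Interpolation.
Context {R : realType}.
Implicit Types (p q : {poly R}) (s : seq R).

Lemma quad_weightE s b :
  quad_weight s b = 2^-1 * pint (-1) 1 (lagrange_basis s b).
Proof. by rewrite /quad_weight Rintegral_poly. Qed.

Lemma lagrange_nth s (b c : nat) : uniq s -> (b < size s)%N -> (c < size s)%N ->
  (lagrange_basis s b).[s`_c] = (b == c)%:R.
Proof.
move=> us bs cs; rewrite horner_prod; case: eqVneq => [<-|nbc].
  rewrite big1 // => i ib; rewrite !hornerE mulVf // subr_eq0 nth_uniq //.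
  by rewrite eq_sym.
by rewrite (bigD1 (Ordinal cs)) /= 1?eq_sym // !hornerE subrr mulr0 mul0r.
Qed.

Lemma size_lagrange_basis s (b : nat) : (b < size s)%N ->
  (size (lagrange_basis s b) <= size s)%N.
Proof.
move=> bs; rewrite /lagrange_basis.
apply: leq_trans (size_poly_prod_leq _ _) _ => /=.
rewrite leq_subLR.
have E : #|(fun c : 'I_(size s) => nat_of_ord c != b)| = (size s).-1.
  rewrite (@eq_card _ _ (predC1 (Ordinal bs))); last by move=> c; rewrite inE.
  by rewrite cardC1 card_ord.
rewrite E; apply: (@leq_ltn_trans (\sum_(c < size s | c != b :> nat) 2)%N).
  apply: leq_sum => c _; apply: leq_trans (size_scale_leq _ _) _.
  by rewrite size_XsubC.
rewrite sum_nat_const E; lia.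
Qed.

(** A nonzero difference would have every node as a root, while its size is at most the number of
    nodes. *)
Lemma lagrange_interp s p : uniq s -> (size p <= size s)%N ->
  p = \sum_(b < size s) p.[s`_b] *: lagrange_basis s b.
Proof.
move=> us sp; apply/eqP; rewrite -subr_eq0; set q := _ - _.
apply: contraT => q0; have := max_poly_roots q0 _ us.
rewrite ltnNge; set sz := (X in ~~ X); have szt : sz.
  rewrite /sz (leq_trans (size_polyD _ _)) // geq_max sp size_polyN.
  apply: leq_trans (size_sum _ _ _) _; apply/bigmax_leqP => b _.
  by apply: leq_trans (size_scale_leq _ _) _; apply: size_lagrange_basis.
rewrite szt; apply => //.
apply/(all_nthP 0) => c cs; rewrite /root /q !hornerE horner_sum.
rewrite (bigD1 (Ordinal cs)) //= big1 ?hornerE ?lagrange_nth ?eqxx //.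
  by rewrite ?mulr1 ?addr0 subrr.
move=> b bc; rewrite hornerE lagrange_nth //.
by rewrite -(inj_eq val_inj) /= in bc; rewrite (negbTE bc) mulr0.
Qed.

(** Here [d] bounds the size and not the degree, whence the shift by one against [quad_exact]. *)
Definition quad_rule s d : Prop := forall p, (size p <= d)%N ->
  \sum_(b < size s) quad_weight s b * p.[s`_b] = 2^-1 * pint (-1) 1 p.

Lemma quad_exactP s d : quad_exact s d <-> quad_rule s d.+1.
Proof.
by split => H p sp; rewrite H //; [rewrite Rintegral_poly|rewrite Rintegral_poly].
Qed.

(* Jacobi's criterion: an interpolatory rule is exact beyond its number of
   nodes as far as its nodal polynomial is orthogonal. *)
Lemma quad_rule_orth s d : uniq s ->
  (forall q, (size q + size s <= d)%N ->
     pint (-1) 1 (q * \prod_(z <- s) ('X - z%:P)) = 0) ->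
  quad_rule s d.
Proof.
move=> us orth p sp; set W := \prod_(z <- s) _ in orth.
have mW : W \is monic by apply: monic_prod_XsubC.
have sW : size W = (size s).+1 by rewrite size_prod_XsubC.
have rW b : (b < size s)%N -> W.[s`_b] = 0.
  by move=> bs; apply/eqP; rewrite -/(root _ _) root_prod_XsubC mem_nth.
(* The multiple of [W] integrates to zero by orthogonality; the remainder has the same values at the
   nodes and is small enough to be interpolated. *)
have -> : pint (-1) 1 p = pint (-1) 1 (p %% W).
  rewrite {1}(divp_eq p W) pintD.
  have [->|q0] := eqVneq (p %/ W) 0; first by rewrite mul0r pint0 add0r.
  rewrite orth ?add0r // size_divp ?monic_neq0 // sW /= subnK //.
  by move: q0; rewrite divpN0 ?monic_neq0 // sW => /ltnW.
have E b : (b < size s)%N -> p.[s`_b] = (p %% W).[s`_b].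
  by move=> bs; rewrite {1}(divp_eq p W) !hornerE rW // mulr0 add0r.
rewrite (@lagrange_interp s (p %% W)) //; last first.
  by rewrite -ltnS -sW ltn_modp monic_neq0.
rewrite pint_sum mulr_sumr; apply: eq_bigr => b _.
by rewrite pintZ quad_weightE E //; ring.
Qed.

(** A test polynomial that vanishes at all other nodes isolates one weight; the sign of its integral
    then decides the sign of the weight. *)
Lemma quad_rule_single s d (b : nat) p : quad_rule s d -> (b < size s)%N ->
  (size p <= d)%N -> (forall c, (c < size s)%N -> c != b -> p.[s`_c] = 0) ->
  quad_weight s b * p.[s`_b] = 2^-1 * pint (-1) 1 p.
Proof.
move=> H bs sp p0; rewrite -H // (bigD1 (Ordinal bs)) //= big1 ?addr0 // => c cb.
by rewrite p0 ?mulr0.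
Qed.

Lemma quad_weight_ge0 s d (b : nat) p : quad_rule s d -> (b < size s)%N ->
  (size p <= d)%N -> (forall c, (c < size s)%N -> c != b -> p.[s`_c] = 0) ->
  (forall t, -1 < t < 1 -> 0 <= p.[t]) -> 0 < p.[s`_b] -> 0 <= quad_weight s b.
Proof.
move=> H bs sp p0 pge pb; rewrite -(pmulr_lge0 _ pb).
rewrite (@quad_rule_single s d) // mulr_ge0 ?invr_ge0 //; apply: pint_ge0 => //.
Qed.

Definition node (I : R * R) (t : R) : R := (I.1 + I.2) / 2 + (I.2 - I.1) / 2 * t.

Lemma pint_quad s d p (I : R * R) : quad_rule s d -> (size p <= d)%N ->
  pint I.1 I.2 p =
    (I.2 - I.1) * \sum_(b < size s) quad_weight s b * p.[node I s`_b].
Proof.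
move=> H sp; rewrite pint_affine; set l := _%:P + _.
have E b : p.[node I s`_b] = (p \Po l).[s`_b].
  by rewrite horner_comp /l !hornerE.
under eq_bigr do rewrite E; rewrite H; first by field.
(* Composition with the affine [l] does not raise the size. The general bound on compositions is at
   least 1, so [p = 0] is treated apart. *)
apply: leq_trans sp; have [->|p0] := eqVneq p 0; first by rewrite comp_poly0.
apply: leq_trans (size_comp_poly_leq _ _) _.
have sl : (size l <= 2)%N.
  apply: leq_trans (size_polyD _ _) _; rewrite geq_max.
  rewrite (leq_trans (size_polyC_leq1 _)) //.
  by apply: leq_trans (size_scale_leq _ _) _; rewrite size_polyX.
have: (0 < size p)%N by rewrite size_poly_gt0.
move: (size l) (size p) sl => x y xl yp; nia.
Qed.

End Interpolation.

(** * Roots and orthogonality of Legendre polynomials *)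

Section LegendreRoots.
Context {R : realType}.
Implicit Types (p q : {poly R}) (s : seq R).

Lemma last_path_ge (x : R) s : path <%R x s -> x <= last x s.
Proof.
elim: s x => //= y s IH x /andP[xy /IH]; exact/le_trans/ltW.
Qed.

(** Rolle's theorem between each two consecutive roots. The new points lie strictly inside the gaps,
    so they are again increasing. *)
Lemma rolle_seq p x s : path <%R x s -> all (root p) (x :: s) ->
  exists s', [/\ size s' = size s, path <%R x s',
    all (fun z => z < last x s) s' & all (root p^`()) s'].
Proof.
elim: s x => [|y s IH] x /=; first by exists [::].
move=> /andP[xy ys] /and3P[px py ps].
have [s' [ss' ys' ls' rs']] := IH y ys (introT andP (conj py ps)).
have [|c] := @polyrcf.poly_rolle _ x y p xy; first by rewrite (rootP px) (rootP py).
rewrite in_itv /= => /andP[xc cy] p'c.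
exists (c :: s'); split => /=.
- by rewrite ss'.
- by rewrite xc; case: s' ys' {ss' ls' rs'} => //= z s' /andP[/(lt_trans cy) ->].
- by rewrite ls' (lt_le_trans cy (last_path_ge _ _ ys)).
- by rewrite rs' andbT; apply/rootP.
Qed.

(** The list has as many distinct roots as the degree permits, so there are no others, and sorting
    fixes their order. *)
Lemma rootsR_eq p s : p != 0 -> (size p <= (size s).+1)%N -> sorted <%R s ->
  all (root p) s ->
  polyrcf.rootsR p = s /\ p = lead_coef p *: \prod_(z <- s) ('X - z%:P).
Proof.
move=> p0 sp ss rs; have us := lt_sorted_uniq ss.
have szp : size p = (size s).+1.
  by apply/eqP; rewrite eqn_leq sp max_poly_roots.
have pE := all_roots_prod_XsubC szp rs (etrans (uniq_rootsE s) us).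
split => //; apply: (irr_sorted_eq lt_trans ltxx) => //.
  exact: polyrcf.sorted_roots.
move=> z; rewrite -polyrcf.roots_on_rootsR // in_itv /= {1}pE rootZ.
  by rewrite root_prod_XsubC.
by rewrite lead_coef_eq0.
Qed.

(** The polynomial differentiated in Rodrigues' formula, without the normalising constant, so that
    its derivatives of all orders can be treated alike. *)
Definition rodrigues n : {poly R} := ('X^2 - 1) ^+ n.

(** One derivative lowers the multiplicity of a root by at most one. *)
Lemma XsubC_exp_dvdp_derivn (a : R) p n m : ('X - a%:P) ^+ (n + m) %| p ->
  ('X - a%:P) ^+ n %| p^`(m).
Proof.
elim: m n => [|m IH] n; first by rewrite addn0 derivn0.
rewrite addnS -addSn => /IH /dvdpP[q qE]; rewrite derivnS qE derivM.
apply: dvdp_add; first by rewrite dvdp_mull // exprS dvdp_mull.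
by rewrite deriv_exp derivXsubC mul1r -scaler_nat dvdp_mull // dvdpZr // pnatr_eq0.
Qed.

Lemma size_derivn p m : size p^`(m) = (size p - m)%N.
Proof.
elim: m => [|m IH]; first by rewrite derivn0 subn0.
by rewrite derivnS polyorder.size_deriv IH subnS.
Qed.

Lemma size_rodrigues n : size (rodrigues n) = n.*2.+1.
Proof.
rewrite /rodrigues -[_ - 1]/('X^2 - 1%:P).
have m1 : ('X^2 - 1%:P : {poly R}) \is monic by rewrite monicXnsubC.
have := size_exp ('X^2 - 1%:P : {poly R}) n; rewrite size_XnsubC //.
have : (0 < size (('X^2 - 1%:P) ^+ n : {poly R}))%N.
  by rewrite size_poly_gt0 expf_neq0 // monic_neq0.
by case: (size _) => //= m _ ->; rewrite mul2n.
Qed.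

Lemma rodrigues_derivn_neq0 n m : (m <= n.*2)%N -> (rodrigues n)^`(m) != 0.
Proof.
by move=> mn; rewrite -size_poly_gt0 size_derivn size_rodrigues subn_gt0 ltnS.
Qed.

Lemma rodrigues_factor n :
  rodrigues n = ('X - 1%:P) ^+ n * ('X - (-1)%:P) ^+ n.
Proof. by rewrite -exprMn /rodrigues; congr (_ ^+ n); rewrite polyCN; ring. Qed.

(** Both ends are roots of [rodrigues n] of multiplicity [n], so they survive fewer than [n]
    derivatives. *)
Lemma rodrigues_root_ends n m : (m < n)%N ->
  root (rodrigues n)^`(m) (-1) && root (rodrigues n)^`(m) 1.
Proof.
move=> mn; rewrite !root_factor_theorem.
have dv (a : R) : ('X - a%:P) ^+ n %| rodrigues n -> 'X - a%:P %| (rodrigues n)^`(m).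
  move=> an; rewrite -['X - _]expr1; apply: XsubC_exp_dvdp_derivn.
  by apply: dvdp_trans an; apply: dvdp_exp2l.
by rewrite !dv // rodrigues_factor; [exact: dvdp_mulr|exact: dvdp_mull].
Qed.

(** [rodrigues n] is even and each derivative switches the parity. *)
Lemma rodrigues_sym n m :
  (rodrigues n)^`(m) \Po - 'X = (-1) ^+ m *: (rodrigues n)^`(m).
Proof.
elim: m => [|m IH].
  rewrite derivn0 scale1r /rodrigues rmorphXn /= comp_polyB comp_Xn_poly.
  by rewrite sqrrN -[1]/(1%:P) comp_polyC.
have := congr1 (@deriv _) IH; rewrite deriv_comp derivZ derivN derivX mulrN1.
by rewrite -!derivnS exprSr mulrN1 scaleNr => /eqP; rewrite eqr_oppLR => /eqP.
Qed.

(* Integration by parts moves all derivatives onto [q]; the boundary terms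
   vanish because the derivatives of order below [n] do at both ends. *)
Lemma rodrigues_orth n m q : (m <= n)%N -> (size q <= m)%N ->
  pint (-1) 1 ((rodrigues n)^`(m) * q) = 0.
Proof.
elim: m q => [|m IH] q mn sq.
  by move: sq; rewrite leqn0 size_poly_eq0 => /eqP ->; rewrite mulr0 pint0.
have /andP[/rootP rN /rootP r1] := rodrigues_root_ends _ _ mn.
have := pint_deriv (-1) 1 ((rodrigues n)^`(m) * q).
rewrite derivM pintD [X in _ + X]IH ?(ltnW mn) // ?addr0 -?derivnS.
  by move=> ->; rewrite !hornerM rN r1 !mul0r subrr.
by rewrite polyorder.size_deriv -subn1 leq_subLR add1n.
Qed.

(** Strictly increasing points of ]-1, 1[, in the form that [rolle_seq] works with. *)
Definition inner_nodes s : bool := path <%R (-1) s && all (fun z => z < 1) s.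

(** For [m < n] the [m] inner roots together with the two ends bound [m + 1] gaps, and Rolle's
    theorem puts a root of the next derivative in each. *)
Lemma rodrigues_derivn_roots n m : (m <= n)%N ->
  exists s, [/\ size s = m, inner_nodes s & all (root (rodrigues n)^`(m)) s].
Proof.
elim: m => [|m IH] mn; first by exists [::].
have [s [ss /andP[s1 s2] rs]] := IH (ltnW mn).
have /andP[rN r1] := rodrigues_root_ends _ _ mn.
have [||s' [ss' ps' ls' rs']] := @rolle_seq (rodrigues n)^`(m) (-1) (rcons s 1).
- rewrite rcons_path s1 /=; case: s {ss s1 rs} s2 => [|z s] //=.
  by move=> s2; apply: (allP (s2 : all (fun t => t < 1) (z :: s))); rewrite mem_last.
- by rewrite /= all_rcons rN r1.
exists s'; split; last by [].
- by rewrite ss' size_rcons ss.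
- by rewrite /inner_nodes ps'; rewrite last_rcons in ls'.
Qed.

(** Past order [n] the ends no longer serve as roots: Rolle's theorem acts between the [n] inner
    roots only, which leaves [n - 1]. *)
Lemma rodrigues_derivnS_roots n : (0 < n)%N -> exists s,
  [/\ size s = n.-1, inner_nodes s & all (root (rodrigues n)^`(n.+1)) s].
Proof.
move=> n0; have [s [ss /andP[s1 s2] rs]] := rodrigues_derivn_roots _ _ (leqnn n).
case: s ss s1 s2 rs => [|x s] /= ss; first by rewrite -ss in n0.
move=> /andP[x1 s1] /andP[x2 s2] rs.
have [s' [ss' ps' ls' rs']] := rolle_seq _ _ _ s1 rs.
exists s'; split; last by [].
- by rewrite ss' -ss.
- rewrite /inner_nodes; apply/andP; split.
    by case: s' ps' {ss' ls' rs'} => //= z s' /andP[/(lt_trans x1) ->].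
  suff le1 : last x s <= 1 by apply: sub_all ls' => z /lt_le_trans; apply.
  case/lastP: s s2 {ss ss' s1 rs ls'}.
    by rewrite ltW.
  by move=> s y; rewrite all_rcons last_rcons => /andP[/ltW].
Qed.

Lemma legendreE n : exists2 c : R, c != 0 & legendre R n = c *: (rodrigues n)^`(n).
Proof.
by exists ((2 ^ n * n`!)%:R)^-1 => //.
Qed.

(** The [n] inner roots exhaust the degree of the derivative, so they are the Gauss nodes and their
    nodal polynomial is proportional to it. *)
Lemma gauss_nodesP n : exists c : R,
  [/\ size (gauss_nodes R n) = n, inner_nodes (gauss_nodes R n) &
      (rodrigues n)^`(n) = c *: \prod_(z <- gauss_nodes R n) ('X - z%:P)].
Proof.
have [s [ss si rs]] := rodrigues_derivn_roots _ _ (leqnn n).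
have [c c0 E] := legendreE n.
have P0 : (rodrigues n)^`(n) != 0 by rewrite rodrigues_derivn_neq0 // -addnn leq_addr.
rewrite /gauss_nodes; have [||||-> LE] := @rootsR_eq (legendre R n) s.
- by rewrite E scaler_eq0 negb_or c0.
- by rewrite E size_scale // size_derivn size_rodrigues ss; lia.
- by have /andP[/path_sorted] := si.
- by apply: sub_all rs => z; rewrite E rootZ.
exists (c^-1 * lead_coef (legendre R n)); split => //.
by rewrite -scalerA -LE E scalerA mulVf // scale1r.
Qed.

(** The inner Lobatto nodes are the roots of the derivative of the Legendre polynomial of degree
    [n - 1], which is one derivative more in Rodrigues' formula. *)
Lemma lobatto_inner_nodesP n : (2 <= n)%N -> exists r c,
  [/\ lobatto_nodes R n = -1 :: rcons r 1, size r = n.-2, inner_nodes r &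
      (rodrigues n.-1)^`(n) = c *: \prod_(z <- r) ('X - z%:P)].
Proof.
case: n => [//|n] n1; have [r [sr ri rr]] := rodrigues_derivnS_roots n n1.
rewrite /lobatto_nodes [n.+1.-1]/= [n.+1.-2]/=.
have [c c0 E] := legendreE n.
have P0 : (rodrigues n)^`(n.+1) != 0 by rewrite rodrigues_derivn_neq0 //; lia.
have E' : (legendre R n)^`() = c *: (rodrigues n)^`(n.+1).
  by rewrite E derivZ derivnS.
have [||||-> LE] := @rootsR_eq (legendre R n)^`() r.
- by rewrite E' scaler_eq0 negb_or c0.
- by rewrite E' size_scale // size_derivn size_rodrigues sr; lia.
- by have /andP[/path_sorted] := ri.
- by apply: sub_all rr => z; rewrite E' rootZ.
exists r, (c^-1 * lead_coef (legendre R n)^`()); split => //.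
by rewrite -scalerA -LE E' scalerA mulVf // scale1r.
Qed.

End LegendreRoots.

(** * Exactness and weights of the Gauss and Gauss-Lobatto rules *)

Section GaussLobatto.
Context {R : realType}.
Implicit Types (p q : {poly R}) (s : seq R).

Lemma eq_scale_inv (c : R) p q : p != 0 -> p = c *: q -> q = c^-1 *: p.
Proof.
move=> p0 pE; have c0 : c != 0.
  by apply: contraNneq p0 => c0; rewrite pE c0 scale0r.
by rewrite pE scalerA mulVf // scale1r.
Qed.

Lemma inner_nodes_bounds s z : inner_nodes s -> z \in s -> -1 < z < 1.
Proof.
move=> /andP[/(order_path_min lt_trans)/allP s1 /allP s2] zs.
by rewrite s1 // s2.
Qed.

Lemma inner_nodes_uniq s : inner_nodes s -> uniq s.
Proof. by move=> /andP[/path_sorted/lt_sorted_uniq]. Qed.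

(** Jacobi's criterion: the nodal polynomial is a multiple of the Legendre polynomial, which is
    orthogonal to all polynomials of size at most [N]. *)
Lemma gauss_quad_rule N : quad_rule (gauss_nodes R N) N.*2.
Proof.
have [c [sz si E]] := @gauss_nodesP R N.
apply: quad_rule_orth => [|q]; first exact: inner_nodes_uniq.
rewrite sz -addnn leq_add2r => sq.
have P0 : (rodrigues N)^`(N) != 0 :> {poly R}.
  by apply: rodrigues_derivn_neq0; rewrite -addnn leq_addr.
rewrite (eq_scale_inv _ _ _ P0 E).
by rewrite -scalerAr pintZ mulrC [q * _]mulrC rodrigues_orth // mul0r.
Qed.

(** The test polynomial is the square of the Lagrange polynomial of the node, of degree at most
    [2N - 2]. *)
Lemma gauss_weight_ge0 N b : (b < size (gauss_nodes R N))%N ->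
  0 <= quad_weight (gauss_nodes R N) b.
Proof.
move=> bN; have [c [sz si _]] := @gauss_nodesP R N.
have us := inner_nodes_uniq _ si; set s := gauss_nodes R N in bN us sz *.
have rule : quad_rule s N.*2 := gauss_quad_rule N.
clearbody s; apply: (@quad_weight_ge0 R s N.*2 b (lagrange_basis s b ^+ 2)) => //.
- rewrite expr2 (leq_trans (size_polyMleq _ _)) //.
  have := size_lagrange_basis _ _ bN; rewrite sz; lia.
- by move=> i iN ib; rewrite horner_exp lagrange_nth // eq_sym (negbTE ib) expr0n.
- by move=> t _; rewrite horner_exp sqr_ge0.
- by rewrite horner_exp lagrange_nth // eqxx expr1n.
Qed.

(** The nodal polynomial is, up to a scalar, X^2 - 1 times the derivative of the Legendre polynomial
    of degree [n - 1]. One integration by parts, whose boundary terms are killed by X^2 - 1, reduces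
    to the orthogonality of the latter. *)
Lemma lobatto_quad_rule n : (2 <= n)%N -> quad_rule (lobatto_nodes R n) (n.*2 - 2).
Proof.
move=> n2; have [r [c [-> sr ri E]]] := @lobatto_inner_nodesP R n n2.
apply: quad_rule_orth => [|q].
  rewrite /= rcons_uniq mem_rcons in_cons negb_or inner_nodes_uniq // andbT.
  have hb z (zr : z \in r) := inner_nodes_bounds _ _ ri zr.
  rewrite -!andbA; apply/and3P; split; first by apply/eqP; lra.
    by apply/negP => /hb; lra.
  by apply/negP => /hb; lra.
rewrite /= size_rcons sr => sq.
set rho := \prod_(z <- r) _ in E.
have -> : \prod_(z <- -1 :: rcons r 1) ('X - z%:P) = rho * ('X^2 - 1).
  rewrite big_cons -cats1 big_cat /= big_seq1 -/rho polyCN; ring.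
have P0 : (rodrigues n.-1)^`(n) != 0 :> {poly R}.
  by apply: rodrigues_derivn_neq0; lia.
rewrite (eq_scale_inv _ _ _ P0 E).
rewrite -scalerAl -scalerAr pintZ; apply/eqP; rewrite mulf_eq0; apply/orP; right.
apply/eqP; case: n n2 sr sq E P0 => [//|n] /= n1 sr sq E P0.
have := pint_deriv (-1) 1 ((rodrigues n)^`(n) * (q * ('X^2 - 1))).
rewrite derivM pintD [X in _ + X]rodrigues_orth //.
  rewrite addr0 -derivnS => H.
  rewrite mulrA [q * _]mulrC -mulrA H !hornerM.
  by rewrite !(hornerD, hornerN, hornerXn, hornerC) sqrrN !expr1n subrr !mulr0 subrr.
rewrite polyorder.size_deriv.
have s3 : (size (q * ('X^2 - 1))%R <= (size q + 3).-1)%N.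
  apply: leq_trans (size_polyMleq _ _) _.
  by rewrite -[1]/(1%:P) size_XnsubC.
move: n1 s3 sq => /=; move: (size (q * _)) (size q) => A B; lia.
Qed.

Lemma size_lobatto_nodes n : (2 <= n)%N -> size (lobatto_nodes R n) = n.
Proof.
move=> n2; have [r [c [-> sr ri E]]] := @lobatto_inner_nodesP R n n2.
by rewrite /= size_rcons sr; lia.
Qed.

Lemma lobatto_first n : (lobatto_nodes R n)`_0 = -1.
Proof. by []. Qed.

Lemma lobatto_last n : (2 <= n)%N -> (lobatto_nodes R n)`_n.-1 = 1.
Proof.
move=> n2; have [r [c [-> sr ri E]]] := @lobatto_inner_nodesP R n n2.
case: n n2 sr E => [//|[//|n]] _ sr _ /=.
by rewrite nth_rcons sr ltnn eqxx.
Qed.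

(** With [rho] the nodal polynomial of the inner nodes, (1 - X) rho^2 and (1 + X) rho^2 isolate the
    weights at -1 and 1; their degree [2n - 3] is just within reach. Reflection exchanges the two
    integrals. *)
Lemma lobatto_weight_ends n : (2 <= n)%N ->
  [/\ quad_weight (lobatto_nodes R n) n.-1 = quad_weight (lobatto_nodes R n) 0 &
      0 <= quad_weight (lobatto_nodes R n) 0].
Proof.
move=> n2; have rule := lobatto_quad_rule _ n2.
have sz := size_lobatto_nodes _ n2; have l0 := lobatto_first n.
have l1 := lobatto_last _ n2.
have [r [c [E sr ri rE]]] := @lobatto_inner_nodesP R n n2.
set s := lobatto_nodes R n in rule sz l0 l1 E *; clearbody s.
set rho := \prod_(z <- r) _ in rE.
have hb z (zr : z \in r) := inner_nodes_bounds _ _ ri zr.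
have inr i : (0 < i < n.-1)%N -> s`_i \in r.
  rewrite E; case: i => //= i; rewrite nth_rcons sr => H.
  have ir : (i < n.-2)%N by lia.
  by rewrite ir mem_nth // sr.
have rho0 i : (0 < i < n.-1)%N -> rho.[s`_i] = 0.
  by move=> /inr H; apply/rootP; rewrite root_prod_XsubC.
have srho (l : R) : (size ((1 + l *: 'X) * rho ^+ 2)%R <= n.*2 - 2)%N.
  have s1 : (size (1 + l *: 'X : {poly R})%R <= 2)%N.
    apply: leq_trans (size_polyD _ _) _; rewrite geq_max size_poly1 /=.
    by apply: leq_trans (size_scale_leq _ _) _; rewrite size_polyX.
  have s2 : size rho = n.-1 by rewrite size_prod_XsubC sr; lia.
  apply: leq_trans (size_polyMleq _ _) _.
  move: (size_polyMleq rho rho) s1; rewrite -expr2 s2.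
  move: (size (rho ^+ 2)) (size (1 + _ : {poly R})%R) => A B; lia.
(* [rho] is proportional to a derivative of an even polynomial, hence even or odd. *)
have sym : (rho ^+ 2) \Po - 'X = rho ^+ 2.
  have rN0 : (rodrigues n.-1)^`(n) != 0 :> {poly R}.
    by apply: rodrigues_derivn_neq0; lia.
  rewrite (eq_scale_inv _ _ _ rN0 rE) exprZn comp_polyZ rmorphXn /=.
  by rewrite rodrigues_sym exprZn -exprM mulnC exprM sqrrN !expr1n scale1r.
have w0 : quad_weight s 0 * (2 * rho.[-1] ^+ 2) =
    2^-1 * pint (-1) 1 ((1 + (-1) *: 'X) * rho ^+ 2).
  rewrite -(@quad_rule_single R s _ 0 _ rule).
  - by rewrite l0 hornerM horner_exp !(hornerD, hornerZ, hornerX, hornerC); ring.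
  - by rewrite sz; lia.
  - exact: srho.
  - move=> i; rewrite sz => iN i0; have [->|i1] := eqVneq i n.-1.
      by rewrite l1 !(hornerM, hornerD, hornerZ, hornerX, hornerC) mulN1r subrr mul0r.
    by rewrite hornerM horner_exp rho0 ?expr0n ?mulr0 //; lia.
have w1 : quad_weight s n.-1 * (2 * rho.[1] ^+ 2) =
    2^-1 * pint (-1) 1 ((1 + 1 *: 'X) * rho ^+ 2).
  rewrite -(@quad_rule_single R s _ n.-1 _ rule).
  - by rewrite l1 hornerM horner_exp !(hornerD, hornerZ, hornerX, hornerC); ring.
  - by rewrite sz; lia.
  - exact: srho.
  - move=> i; rewrite sz => iN i0; have [->|i1] := eqVneq i 0%N.
      by rewrite l0 !(hornerM, hornerD, hornerZ, hornerX, hornerC) mul1r subrr mul0r.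
    by rewrite hornerM horner_exp rho0 ?expr0n ?mulr0 //; lia.
have pE : pint (-1) 1 ((1 + 1 *: 'X) * rho ^+ 2) =
          pint (-1) 1 ((1 + (-1) *: 'X) * rho ^+ 2).
  rewrite -[LHS]pint_opp comp_polyM sym; congr (pint _ _ (_ * _)).
  by rewrite comp_polyD comp_polyZ comp_polyX -[1]/(1%:P) comp_polyC scalerN scaleNr.
have rE1 : rho.[1] ^+ 2 = rho.[-1] ^+ 2.
  by rewrite -!horner_exp -{1}sym horner_comp hornerN hornerX.
have rpos : 0 < 2 * rho.[-1] ^+ 2.
  rewrite mulr_gt0 // lt_neqAle sqr_ge0 andbT eq_sym sqrf_eq0 -rootE.
  rewrite root_prod_XsubC; apply/negP => /hb; lra.
split.
  by apply: (mulIf (lt0r_neq0 rpos)); rewrite w0 -pE -rE1 w1.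
rewrite -(pmulr_lge0 _ rpos) w0 mulr_ge0 ?invr_ge0 // pint_ge0 // => t tb.
rewrite hornerM horner_exp mulr_ge0 ?sqr_ge0 //.
rewrite !(hornerD, hornerZ, hornerX, hornerC); lra.
Qed.

(** At an inner node the test polynomial is 1 - X^2, which removes both ends, times the square of
    the Lagrange polynomial on the inner nodes alone. *)
Lemma lobatto_weight_ge0 n b : (2 <= n)%N -> (b < n)%N ->
  0 <= quad_weight (lobatto_nodes R n) b.
Proof.
move=> n2 bn; have [e1 e0] := lobatto_weight_ends _ n2.
have [->//|b0] := eqVneq b 0%N.
have [->|b1] := eqVneq b n.-1; first by rewrite e1.
have rule := lobatto_quad_rule _ n2; have sz := size_lobatto_nodes _ n2.
have l1 := lobatto_last _ n2.
have [r [c [E sr ri _]]] := @lobatto_inner_nodesP R n n2.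
have ur := inner_nodes_uniq _ ri.
set s := lobatto_nodes R n in rule sz l1 E e1 e0 *.
clearbody s; have l0 : s`_0 = -1 by rewrite E.
(* The node -1 in front shifts the indices of the inner nodes by one. *)
have sE i : (0 < i < n.-1)%N -> (i.-1 < size r)%N /\ s`_i = r`_i.-1.
  rewrite E; case: i => //= i H; rewrite nth_rcons sr.
  have ir : (i < n.-2)%N by lia.
  by rewrite ir.
have [br bE] := sE b ltac:(lia).
apply: (@quad_weight_ge0 R s _ b ((1 - 'X^2) * lagrange_basis r b.-1 ^+ 2) rule).
- by rewrite sz.
- apply: leq_trans (size_polyMleq _ _) _; rewrite expr2.
  have sX : size (1 - 'X^2 : {poly R}) = 3.
    by rewrite -opprB size_polyN -[1]/(1%:P) size_XnsubC.
  have := size_polyMleq (lagrange_basis r b.-1) (lagrange_basis r b.-1).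
  have := size_lagrange_basis _ _ br; rewrite sX.
  have : (0 < n.-2)%N by lia.
  rewrite sr; move: (size (lagrange_basis _ _)) (size (_ * _ : {poly R})%R) => A B; lia.
- move=> i; rewrite sz => iN ib.
  rewrite hornerM !(hornerD, hornerN, hornerXn, hornerC).
  have [->|i0] := eqVneq i 0%N; first by rewrite l0 sqrrN expr1n subrr mul0r.
  have [->|i1] := eqVneq i n.-1; first by rewrite l1 expr1n subrr mul0r.
  have [ir ->] := sE i ltac:(lia).
  rewrite horner_exp lagrange_nth //.
  have /negbTE -> : b.-1 != i.-1 by lia.
  by rewrite expr0n mulr0.
- move=> t tb; rewrite hornerM horner_exp mulr_ge0 ?sqr_ge0 //.
  rewrite !(hornerD, hornerN, hornerXn, hornerC); nra.
- rewrite hornerM horner_exp bE lagrange_nth // eqxx expr1n mulr1.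
  have := inner_nodes_bounds _ _ ri (mem_nth 0 br).
  rewrite !(hornerD, hornerN, hornerXn, hornerC); nra.
Qed.

End GaussLobatto.

(** * Integrals of bivariate polynomials over rectangles *)

Section RectangleIntegral.
Context {R : realType}.
Implicit Types (P Q : {poly {poly R}}) (I J : R * R).
Local Notation mu := (@lebesgue_measure R).
Local Notation mu2 := (@lebesgue_measure R \x @lebesgue_measure R)%E.

(** The outer variable of [P] is x and its coefficients are polynomials in y: [P.[x%:P]] freezes x,
    while freezing y acts on the coefficients. *)
Definition slice P (y : R) : {poly R} := map_poly (horner_eval y) P.

Lemma peval_slice P z : peval P z = (slice P z.2).[z.1].
Proof.
rewrite /peval /slice -[in RHS](hornerC z.1 z.2) -[_.[z.2]]/(horner_eval z.2 _).
by rewrite horner_map.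
Qed.

Lemma size_slice k P y : total_degree_le k P -> (size (slice P y) <= k.+1)%N.
Proof.
move=> Pk; apply: leq_trans (size_poly _ _) _; apply/leq_sizeP => i ki.
by apply/polyP => j; rewrite Pk ?coef0 //; lia.
Qed.

Lemma size_horner k P (x : R) : total_degree_le k P -> (size P.[x%:P] <= k.+1)%N.
Proof.
move=> Pk; apply/leq_sizeP => j kj; rewrite horner_coef coef_sum big1 // => i _.
by rewrite -polyC_exp coefMC Pk ?mul0r //; lia.
Qed.

Lemma peval_bounded P I J : exists M, forall z, box I J z -> `|peval P z| <= M.
Proof.
elim/poly_ind: P => [|P c [M HM]].
  by exists 0 => z _; rewrite /peval !horner0 normr0.
have [X HX] := poly_itv_bound ('X : {poly R}) I.1 I.2.
have [C HC] := poly_itv_bound c J.1 J.2.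
exists (M * X + C) => z [zI zJ].
rewrite /peval !hornerE (le_trans (ler_normD _ _)) // normrM.
apply: lerD; last by apply: HC; move: zJ; rewrite /= in_itv.
apply: ler_pM => //; first exact: HM.
by have := HX z.1; rewrite hornerX; apply; move: zI; rewrite /= in_itv.
Qed.

Lemma measurable_peval P : measurable_fun [set: R * R] (peval P).
Proof.
elim/poly_ind: P => [|P c mP].
  by rewrite (_ : peval 0 = cst 0) //; apply/funext => z; rewrite /peval !horner0.
rewrite (_ : peval _ = (peval P \* fst) \+ (horner c \o snd)); last first.
  by apply/funext => z; rewrite /peval !hornerE.
apply: measurable_funD; first by apply: measurable_funM => //; exact: measurable_fst.
apply: measurableT_comp; last exact: measurable_snd.
by apply: continuous_measurable_fun; exact: continuous_horner.
Qed.

(** The right end is dropped for [b = true] and kept for [b = false]; half-open pieces allow a cell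
    to be partitioned. *)
Definition side_itv (I : R * R) (b : bool) : set R :=
  [set` Interval (BLeft I.1) (BSide b I.2)].

Lemma side_itvS I b : side_itv I b `<=` `[I.1, I.2].
Proof.
by move=> t; rewrite /side_itv /= !in_itv /= => /andP[->]; case: b => //= /ltW.
Qed.

Lemma measurable_side_itv I b : measurable (side_itv I b).
Proof. exact: measurable_itv. Qed.

Lemma integrable_poly_side I b (p : {poly R}) :
  mu.-integrable (side_itv I b) (EFin \o horner p).
Proof.
apply: integrableS (integrable_poly I.1 I.2 p) => //.
  exact: measurable_side_itv.
exact: side_itvS.
Qed.

Lemma Rintegral_poly_side I b (p : {poly R}) : I.1 <= I.2 ->
  \int[mu]_(t in side_itv I b) p.[t] = pint I.1 I.2 p.
Proof.
move=> I12; rewrite -Rintegral_poly //; case: b => //.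
rewrite Rintegral_itv_bndo_bndc //; exact: (integrable_poly_side I true).
Qed.

Definition dint I J P : R := \int[mu]_(x in `[I.1, I.2]) pint J.1 J.2 P.[x%:P].

Lemma integrable_peval_side I J b c P :
  mu2.-integrable (side_itv I b `*` side_itv J c) (EFin \o peval P).
Proof.
apply: measurable_bounded_integrable.
- by apply: measurableX; exact: measurable_side_itv.
- rewrite [X in (X < _)%E](_ : _ = mu (side_itv I b) * mu (side_itv J c))%E;
    last by apply: product_measure1E; exact: measurable_side_itv.
  rewrite /side_itv !lebesgue_measure_itv /=.
  by do 2 case: ifP => _; rewrite ?mule0 ?mul0e ?lt0y // -!EFinB -EFinM ltry.
- exact: measurable_funS (measurable_peval P).
- have [M HM] := peval_bounded P I J.
  exists M; split; first exact: num_real.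
  move=> x Mx z [zI zJ]; apply/ltW/(le_lt_trans _ Mx)/HM.
  by split; [exact: side_itvS zI|exact: side_itvS zJ].
Qed.

(** Integrating y out leaves a polynomial in x, so the univariate theory applies once more. *)
Definition slice_int J P : {poly R} :=
  \sum_(i < size P) pint J.1 J.2 P`_i *: 'X^i.

Lemma slice_intE J P x : pint J.1 J.2 P.[x%:P] = (slice_int J P).[x].
Proof.
rewrite horner_coef pint_sum /slice_int horner_sum; apply: eq_bigr => i _.
by rewrite -polyC_exp mulrC mul_polyC pintZ hornerZ hornerXn mulrC.
Qed.

Lemma Rintegral_peval_side I J b c P : I.1 <= I.2 -> J.1 <= J.2 ->
  \int[mu2]_(z in side_itv I b `*` side_itv J c) peval P z = dint I J P.
Proof.
move=> I12 J12; rewrite /dint; under [RHS]eq_Rintegral do rewrite slice_intE.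
rewrite Rintegral_poly // -(Rintegral_poly_side I b) // /Rintegral.
(* Fubini's theorem is applied to the extension by zero to the plane, whose sections are extensions
   by zero or vanish identically. *)
congr fine; rewrite integral_mkcond -integral12_prod_meas1; last first.
  apply/(integrable_mkcond _ _).1; first by apply: measurableX; exact: measurable_side_itv.
  exact: integrable_peval_side.
rewrite [RHS]integral_mkcond; apply: eq_integral => x _; rewrite /fubini_F.
rewrite [RHS]patchE; case: ifPn => [xI|xI].
  rewrite -slice_intE -(Rintegral_poly_side J c) // /Rintegral fineK; last first.
    by apply: integrable_fin_num; [exact: measurable_side_itv|exact: integrable_poly_side].
  rewrite [RHS]integral_mkcond; apply: eq_integral => y _; rewrite !patchE.
  by congr (if _ then _ else _); rewrite in_setX /= xI.
apply: integral0_eq => y _; rewrite patchE in_setX /= (negbTE xI) //.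
Qed.

(** Tensor product of two rules: the one in y, at fixed x, produces a polynomial [q] in x of size at
    most [k + 1], to which the one in x applies. *)
Lemma dint_quad s d s' d' I J k P : I.1 <= I.2 -> total_degree_le k P ->
  quad_rule s d -> quad_rule s' d' -> (k < d)%N -> (k < d')%N ->
  dint I J P = (I.2 - I.1) * (J.2 - J.1) *
    \sum_(a < size s) \sum_(b < size s') quad_weight s a * quad_weight s' b *
      peval P (node I s`_a, node J s'`_b).
Proof.
move=> I12 Pk rs rs' kd kd'.
pose q := (J.2 - J.1) *: \sum_(b < size s') quad_weight s' b *: slice P (node J s'`_b).
have qE x : pint J.1 J.2 P.[x%:P] = q.[x].
  rewrite (pint_quad _ _ _ _ rs') ?(leq_trans (size_horner _ _ _ Pk)) //.
  rewrite hornerZ horner_sum; congr (_ * _); apply: eq_bigr => b _.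
  by rewrite hornerZ -[LHS]/(_ * peval P (x, _)) peval_slice.
have sq : (size q <= d)%N.
  apply: leq_trans (size_scale_leq _ _) _; apply: leq_trans (size_sum _ _ _) _.
  apply/bigmax_leqP => b _; apply: leq_trans (size_scale_leq _ _) _.
  exact: leq_trans (size_slice _ _ _ Pk) kd.
rewrite /dint; under eq_Rintegral do rewrite qE.
rewrite Rintegral_poly // (pint_quad _ _ _ _ rs) // -!mulrA.
congr (_ * _); rewrite mulr_sumr; apply: eq_bigr => a _.
rewrite hornerZ horner_sum !mulr_sumr; apply: eq_bigr => b _.
by rewrite hornerZ peval_slice; ring.
Qed.

End RectangleIntegral.

(** * Splitting a cell into its four quarters *)

Section CellSplit.
Context {R : realType}.
Implicit Types (P : {poly {poly R}}) (I J : R * R).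
Local Notation mu := (@lebesgue_measure R).
Local Notation mu2 := (@lebesgue_measure R \x @lebesgue_measure R)%E.

(** Unlike [half], defined for any interval, so that primal and dual cells are treated together. *)
Definition half_of I (l : bool) : R * R :=
  if l then ((I.1 + I.2) / 2, I.2) else (I.1, (I.1 + I.2) / 2).

(* The left half loses its right endpoint, so that the two halves partition
   the closed interval. *)
Definition half_itv I (l : bool) : set R := side_itv (half_of I l) (~~ l).

Lemma half_of_le I l : I.1 <= I.2 -> (half_of I l).1 <= (half_of I l).2.
Proof. by case: l => /=; lra. Qed.

Lemma half_itvU I : I.1 <= I.2 ->
  `[I.1, I.2]%classic = half_itv I false `|` half_itv I true.
Proof.
move=> I12; rewrite /half_itv /side_itv /=; apply/seteqP; split => t /=.
  rewrite !in_itv /= => /andP[-> ->]; rewrite andbT.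
  by case: ltP; [left|right].
by rewrite !in_itv /= => -[|] /andP[]; rewrite ?ltEsub; lra.
Qed.

Lemma half_itv_disj I : half_itv I false `&` half_itv I true = set0.
Proof.
apply/seteqP; split => t //=; rewrite /half_itv /side_itv /= !in_itv /=; lra.
Qed.

(** Integrability of [f] belongs to the conclusion so that the lemma can be iterated: it joins
    quarters in pairs and then joins the pairs. *)
Lemma Rintegral_setU_eq d (T : measurableType d) (nu : {measure set T -> \bar R})
  (A B : set T) (f g h : T -> R) : measurable A -> measurable B ->
  A `&` B = set0 ->
  nu.-integrable A (EFin \o g) -> nu.-integrable B (EFin \o h) ->
  (forall t, A t -> f t = g t) -> (forall t, B t -> f t = h t) ->
  nu.-integrable (A `|` B) (EFin \o f) /\
  \int[nu]_(t in A `|` B) f t = \int[nu]_(t in A) g t + \int[nu]_(t in B) h t.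
Proof.
move=> mA mB AB ig ih fg fh.
have eA : {in A, f =1 g} by move=> t /set_mem /fg.
have eB : {in B, f =1 h} by move=> t /set_mem /fh.
have ifA : nu.-integrable A (EFin \o f).
  by apply: eq_integrable ig => // t /eA /= ->.
have ifB : nu.-integrable B (EFin \o f).
  by apply: eq_integrable ih => // t /eB /= ->.
have ifU : nu.-integrable (A `|` B) (EFin \o f).
  have /integrableP[mfA fA] := ifA; have /integrableP[mfB fB] := ifB.
  have mf : measurable_fun (A `|` B) (EFin \o f) by apply/measurable_funU.
  apply/integrableP; split=> //.
  rewrite ge0_integral_setU //; [exact: lte_add_pinfty|exact: measurableT_comp|].
  by apply/disj_setPS; rewrite AB.
split=> //; rewrite Rintegral_setU //; last by apply/disj_setPS; rewrite AB.
by congr (_ + _); apply: eq_Rintegral.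
Qed.

Lemma Rintegral_pw_poly J (f : R -> R) (p : bool -> {poly R}) : J.1 <= J.2 ->
  (forall m t, half_itv J m t -> f t = (p m).[t]) ->
  \int[mu]_(t in `[J.1, J.2]) f t =
    \sum_(m : bool) pint (half_of J m).1 (half_of J m).2 (p m).
Proof.
move=> J12 fp; rewrite half_itvU //.
have [_ ->] := @Rintegral_setU_eq _ _ mu (half_itv J false) (half_itv J true) f
  (horner (p false)) (horner (p true)) (measurable_side_itv _ _)
  (measurable_side_itv _ _) (half_itv_disj J) (integrable_poly_side _ _ _)
  (integrable_poly_side _ _ _) (fp false) (fp true).
by rewrite !Rintegral_poly_side ?half_of_le // big_bool addrC.
Qed.

Lemma box_int_pw_poly I J (f : R * R -> R) (P : bool -> bool -> {poly {poly R}}) :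
  I.1 <= I.2 -> J.1 <= J.2 ->
  (forall l m z, half_itv I l z.1 -> half_itv J m z.2 -> f z = peval (P l m) z) ->
  box_int I J f =
    \sum_(l : bool) \sum_(m : bool) dint (half_of I l) (half_of J m) (P l m).
Proof.
move=> I12 J12 fP; rewrite /box_int /box (half_itvU _ I12) (half_itvU _ J12).
pose Q l m := half_itv I l `*` half_itv J m.
have mQ l m : measurable (Q l m).
  by apply: measurableX; exact: measurable_side_itv.
have fQ l m z : Q l m z -> f z = peval (P l m) z by move=> [/fP H /H].
have iQ l m : mu2.-integrable (Q l m) (EFin \o peval (P l m)).
  exact: integrable_peval_side.
have row l : mu2.-integrable (Q l false `|` Q l true) (EFin \o f) /\
    \int[mu2]_(z in Q l false `|` Q l true) f z =
    \sum_(m : bool) dint (half_of I l) (half_of J m) (P l m).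
  have dj : Q l false `&` Q l true = set0.
    by rewrite /Q -setXI half_itv_disj setX0.
  have [i ->] := @Rintegral_setU_eq _ _ mu2 _ _ f _ _ (mQ l false) (mQ l true) dj
    (iQ l false) (iQ l true) (fQ l false) (fQ l true).
  split => //; rewrite big_bool addrC /Q /half_itv.
  by rewrite !Rintegral_peval_side ?half_of_le.
rewrite (_ : _ `*` _ =
  (Q false false `|` Q false true) `|` (Q true false `|` Q true true)); last first.
  by rewrite predeqE => z; rewrite /Q /setX /setU /mkset /=; tauto.
have [i0 e0] := row false; have [i1 e1] := row true.
have dj : (Q false false `|` Q false true) `&` (Q true false `|` Q true true) = set0.
  apply/seteqP; split => // z /=.
  have /seteqP[/(_ z.1) H _] := half_itv_disj I.
  by rewrite /Q /setX /setU /mkset /= => H'; apply: H; rewrite /setI /mkset; tauto.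
have mU l : measurable (Q l false `|` Q l true) by apply: measurableU.
have [_ ->] := @Rintegral_setU_eq _ _ mu2 _ _ f f f (mU false) (mU true) dj i0 i1
  (fun _ _ => erefl) (fun _ _ => erefl).
by rewrite e0 e1 [RHS]big_bool addrC.
Qed.

End CellSplit.

(** * Fluxes against the mean on one quarter *)

Section CellUpdate.
Context {R : realType}.
Implicit Types (P U V : {poly {poly R}}) (I J : R * R).

Definition quad_sum (s : seq R) J (p : {poly R}) : R :=
  \sum_(b < size s) quad_weight s b * p.[node J s`_b].

Definition edge I (l : bool) : R := if l then I.2 else I.1.

(** By exactness the flux is a weighted sum of nodal products; the weights and the values of [p] are
    nonnegative, so |u| can be bounded term by term. *)
Lemma flux_bound s d J (p u : {poly R}) (M : R) : quad_rule s d -> J.1 <= J.2 ->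
  (forall b, (b < size s)%N -> 0 <= quad_weight s b) ->
  (size (p * u)%R <= d)%N ->
  (forall b, (b < size s)%N -> 0 <= p.[node J s`_b]) ->
  (forall b, (b < size s)%N -> `|u.[node J s`_b]| <= M) ->
  `|pint J.1 J.2 (p * u)| <= (J.2 - J.1) * (M * quad_sum s J p).
Proof.
move=> rs J12 w0 spu p0 uM; rewrite (pint_quad _ _ _ _ rs) // normrM ger0_norm ?subr_ge0 //.
rewrite ler_wpM2l ?subr_ge0 // /quad_sum mulr_sumr (le_trans (ler_norm_sum _ _ _)) //.
apply: ler_sum => b _; rewrite hornerM [X in `|X|]mulrA normrM.
have wp : 0 <= quad_weight s b * p.[node J s`_b].
  by apply: mulr_ge0; [exact: w0|exact: p0].
by rewrite (ger0_norm wp) mulrC ler_wpM2r ?uM.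
Qed.

Lemma ler_sum_single (n a : nat) (F : nat -> R) : (a < n)%N ->
  (forall i, (i < n)%N -> 0 <= F i) -> F a <= \sum_(i < n) F i.
Proof.
move=> an F0; rewrite (bigD1 (Ordinal an)) //= lerDl.
by apply: sumr_ge0 => i _; apply: F0; exact: ltn_ord.
Qed.

(* All that the argument needs from a Gauss rule [g] and a Gauss-Lobatto rule
   [t] with end weight [w0]. *)
Record quad_pair (k : nat) (g t : seq R) (w0 : R) : Prop := QuadPair {
  qp_inner : quad_rule g (2 * k + 2);
  qp_outer : quad_rule t k.+1;
  qp_inner_ge0 : forall b, (b < size g)%N -> 0 <= quad_weight g b;
  qp_outer_ge0 : forall b, (b < size t)%N -> 0 <= quad_weight t b;
  qp_inner_in : forall b, (b < size g)%N -> -1 <= g`_b <= 1;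
  qp_ends : forall l : bool, exists2 a, (a < size t)%N &
    t`_a = (if l then 1 else -1) /\ quad_weight t a = w0 }.

Lemma gauss_lobatto_quad_pair (N Nh k : nat) :
  (2 <= Nh)%N -> (k <= 2 * Nh - 3)%N ->
  quad_exact (gauss_nodes R N) (2 * k + 1) ->
  quad_pair k (gauss_nodes R N) (lobatto_nodes R Nh) (lobatto_end_weight R Nh).
Proof.
move=> hNh2 hNh hN; have sz := @size_lobatto_nodes R _ hNh2.
split.
- by move/quad_exactP : hN; rewrite -addn1 -addnA.
- by move=> p sp; apply: (lobatto_quad_rule _ hNh2); apply: leq_trans sp _; lia.
- by move=> b; apply: gauss_weight_ge0.
- by rewrite sz => b; apply: lobatto_weight_ge0.
- move=> b bg; have [c [_ gi _]] := @gauss_nodesP R N.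
  by have /andP[/ltW -> /ltW ->] := inner_nodes_bounds _ _ gi (mem_nth 0 bg).
- have [e _] := @lobatto_weight_ends R _ hNh2.
  case; [exists Nh.-1|exists 0%N]; rewrite ?sz; try lia; split.
  + exact: lobatto_last.
  + exact: e.
  + exact: lobatto_first.
  + reflexivity.
Qed.

Section Quarter.
Variables (k : nat) (g t : seq R) (w0 : R).
Hypothesis gt_pair : quad_pair k g t w0.
Variables (P : {poly {poly R}}) (I J : R * R).
Hypothesis Pk : total_degree_le k P.
Hypotheses (I12 : I.1 <= I.2) (J12 : J.1 <= J.2).
Hypothesis P0 : forall z,
  ((nodes_on g I `*` nodes_on t J) `|` (nodes_on t I `*` nodes_on g J)) z ->
  0 <= peval P z.

Let node_mem (s : seq R) K b : (b < size s)%N -> nodes_on s K (node K s`_b).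
Proof. by move=> bs; exists s`_b => //=; exact: mem_nth. Qed.

Let end_node l : exists2 a, (a < size t)%N &
  (forall K, node K t`_a = edge K l) /\ quad_weight t a = w0.
Proof.
have [a at_ [ta wa]] := qp_ends _ _ _ _ gt_pair l; exists a => //; split => // K.
by rewrite ta /node; case: (l) => /=; field.
Qed.

Let rule_g := qp_inner _ _ _ _ gt_pair.
Let rule_t := qp_outer _ _ _ _ gt_pair.
Let wg := qp_inner_ge0 _ _ _ _ gt_pair.
Let wt := qp_outer_ge0 _ _ _ _ gt_pair.

(** Lobatto in x, Gauss in y: all terms are nonnegative, and only those of the Lobatto node on the
    edge are kept. *)
Lemma dint_ge_vertical l :
  (I.2 - I.1) * (J.2 - J.1) * (w0 * quad_sum g J P.[(edge I l)%:P]) <= dint I J P.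
Proof.
have [a ta [ae aw]] := end_node l.
rewrite (dint_quad _ _ _ _ _ _ _ _ I12 Pk rule_t rule_g); try lia.
rewrite ler_wpM2l ?mulr_ge0 ?subr_ge0 //.
pose F i := quad_weight t i * \sum_(b < size g) quad_weight g b *
  peval P (node I t`_i, node J g`_b).
rewrite -aw -(ae I) (_ : _ * quad_sum _ _ _ = F a) //.
rewrite [leRHS](_ : _ = \sum_(i < size t) F i); last first.
  by apply: eq_bigr => i _; rewrite /F mulr_sumr; apply: eq_bigr => b _; rewrite mulrA.
apply: ler_sum_single => // i it; rewrite mulr_ge0 //.
  exact: wt.
apply: sumr_ge0 => b _; rewrite mulr_ge0 ?wg //.
by apply: P0; right; split; exact: node_mem.
Qed.

(** The same with Gauss in x and Lobatto in y. *)
Lemma dint_ge_horizontal m :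
  (I.2 - I.1) * (J.2 - J.1) * (w0 * quad_sum g I (slice P (edge J m))) <= dint I J P.
Proof.
have [a ta [ae aw]] := end_node m.
rewrite (dint_quad _ _ _ _ _ _ _ _ I12 Pk rule_g rule_t); try lia.
rewrite ler_wpM2l ?mulr_ge0 ?subr_ge0 //.
pose F i := quad_weight t i * \sum_(b < size g) quad_weight g b *
  peval P (node I g`_b, node J t`_i).
rewrite -aw -(ae J) (_ : _ * quad_sum _ _ _ = F a); last first.
  by congr (_ * _); apply: eq_bigr => b _; rewrite peval_slice.
rewrite [leRHS](_ : _ = \sum_(i < size t) F i); last first.
  rewrite exchange_big; apply: eq_bigr => i _; rewrite /F mulr_sumr.
  by apply: eq_bigr => b _; rewrite mulrA [_ * quad_weight t i]mulrC.
apply: ler_sum_single => // i it; rewrite mulr_ge0 //.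
  exact: wt.
apply: sumr_ge0 => b _; rewrite mulr_ge0 ?wg //.
by apply: P0; left; split; exact: node_mem.
Qed.

Lemma node_gauss_in K b : K.1 <= K.2 -> (b < size g)%N ->
  K.1 <= node K g`_b <= K.2.
Proof.
move=> K12 /(qp_inner_in _ _ _ _ gt_pair); rewrite /node; move: g`_b => x x1; nra.
Qed.

Variables (l m : bool) (dx dy theta dt ax ay : R) (U V : {poly {poly R}}).
Hypotheses (dx0 : 0 < dx) (dy0 : 0 < dy) (dt0 : 0 < dt) (theta0 : 0 <= theta).
Hypotheses (Idx : I.2 - I.1 = dx / 2) (Jdy : J.2 - J.1 = dy / 2).
Hypotheses (Uk : total_degree_le k U) (Vk : total_degree_le k V).
Hypothesis Ua : forall z, box I J z -> `|peval U z| <= ax.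
Hypothesis Va : forall z, box I J z -> `|peval V z| <= ay.
Hypothesis cfl : dt / dx * ax + dt / dy * ay <= 4^-1 * theta * w0.

Let edge_in K e : K.1 <= K.2 -> K.1 <= edge K e <= K.2.
Proof. by case: e => /= K12; rewrite K12 lexx. Qed.

Lemma quarter_ge :
  dt * (`|pint J.1 J.2 (P.[(edge I l)%:P] * U.[(edge I l)%:P])| +
        `|pint I.1 I.2 (slice P (edge J m) * slice V (edge J m))|)
  <= theta * dint I J P.
Proof.
have sg (p q : {poly R}) : (size p <= k.+1)%N -> (size q <= k.+1)%N ->
    (size (p * q)%R <= 2 * k + 2)%N.
  by move=> sp sq; apply: leq_trans (size_polyMleq _ _) _; lia.
have [a ta [ae _]] := end_node l; have [a' ta' [ae' _]] := end_node m.
have px b : (b < size g)%N -> 0 <= (P.[(edge I l)%:P]).[node J g`_b].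
  move=> bg; rewrite -(ae I); apply: (P0 (node I t`_a, node J g`_b)).
  by right; split; exact: node_mem.
have py b : (b < size g)%N -> 0 <= (slice P (edge J m)).[node I g`_b].
  move=> bg; rewrite -(ae' J) -[X in 0 <= X](peval_slice P (node I g`_b, _)).
  by apply: P0; left; split; exact: node_mem.
have fx := flux_bound g _ J _ U.[(edge I l)%:P] ax rule_g J12 wg
  (sg _ _ (size_horner _ _ _ Pk) (size_horner _ _ _ Uk)) px.
have fy := flux_bound g _ I _ (slice V (edge J m)) ay rule_g I12 wg
  (sg _ _ (size_slice _ _ _ Pk) (size_slice _ _ _ Vk)) py.
have {}fx := fx (fun b bg => Ua (edge I l, node J g`_b)
  (conj (edge_in I l I12) (node_gauss_in J b J12 bg))).
have {}fy : `|pint I.1 I.2 (slice P (edge J m) * slice V (edge J m))| <=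
    (I.2 - I.1) * (ay * quad_sum g I (slice P (edge J m))).
  apply: fy => b bg; rewrite -[X in `|X|](peval_slice V (node I g`_b, _)).
  by apply: Va; split; [exact: node_gauss_in|exact: edge_in].
have := dint_ge_vertical l; have := dint_ge_horizontal m.
move: fx fy; rewrite Idx Jdy.
have : 0 <= quad_sum g J P.[(edge I l)%:P].
  by apply: sumr_ge0 => b _; rewrite mulr_ge0 ?wg ?px.
have : 0 <= quad_sum g I (slice P (edge J m)).
  by apply: sumr_ge0 => b _; rewrite mulr_ge0 ?wg ?py.
have : 0 <= ax.
  apply: le_trans (Ua (edge I l, edge J m) _); rewrite ?normr_ge0 //.
  by split; exact: edge_in.
have : 0 <= ay.
  apply: le_trans (Va (edge I l, edge J m) _); rewrite ?normr_ge0 //.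
  by split; exact: edge_in.
move: cfl; move: `|_| `|_| (quad_sum _ _ _) (quad_sum _ _ _) (dint _ _ _).
move=> Y X A B D cfl' ay0 ax0 B0 A0 hX hY hB hA.
(* [X] and [A] are the flux and the Gauss sum of the vertical edge, [Y] and [B] those of the
   horizontal one; [c1] and [c2] are the two parts of the CFL number. *)
set c1 := dt / dx * ax in cfl'; set c2 := dt / dy * ay in cfl'.
have c1E : dt * ax = c1 * dx by rewrite /c1; field; rewrite gt_eqF.
have c2E : dt * ay = c2 * dy by rewrite /c2; field; rewrite gt_eqF.
have c10 : 0 <= c1 by rewrite mulr_ge0 // divr_ge0 // ltW.
have c20 : 0 <= c2 by rewrite mulr_ge0 // divr_ge0 // ltW.
have {hX} : dt * X <= dx * dy * (c1 * A) / 2.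
  have -> : dx * dy * (c1 * A) / 2 = dt * (dy / 2 * (ax * A)).
    by rewrite [RHS](_ : _ = dt * ax * (dy / 2 * A)) ; [rewrite c1E; field|ring].
  by rewrite ler_pM2l.
have {hY} : dt * Y <= dx * dy * (c2 * B) / 2.
  have -> : dx * dy * (c2 * B) / 2 = dt * (dx / 2 * (ay * B)).
    by rewrite [RHS](_ : _ = dt * ay * (dx / 2 * B)) ; [rewrite c2E; field|ring].
  by rewrite ler_pM2l.
have d0 : 0 < dx * dy by rewrite mulr_gt0.
(* [M] will be the larger of [A] and [B], so a single lower bound of [D] pays for both edges. The
   factor 1/4 of the CFL condition is the share of the quarter in the area [dx * dy]. *)
have key M : 0 <= M -> A <= M -> B <= M ->
    dx / 2 * (dy / 2) * (w0 * M) <= D -> dx * dy * (c1 * A + c2 * B) <= theta * D.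
  move=> M0 AM BM /(ler_wpM2l theta0); apply: le_trans.
  have -> : theta * (dx / 2 * (dy / 2) * (w0 * M)) =
      dx * dy * ((4^-1 * theta * w0) * M) by field.
  rewrite ler_pM2l //; apply: le_trans (ler_wpM2r M0 cfl'); rewrite mulrDl.
  by rewrite lerD // ler_wpM2l.
have {key} : dx * dy * (c1 * A + c2 * B) <= theta * D.
  by have [AB|/ltW BA] := leP A B; [exact: (key B)|exact: (key A)].
have := mulr_ge0 (ltW d0) (mulr_ge0 c10 A0).
have := mulr_ge0 (ltW d0) (mulr_ge0 c20 B0).
lra.
Qed.

End Quarter.
End CellUpdate.

(** * Assembling the quarters of one cell *)

Section NewAverage.
Context {R : realType}.

(* The update of a cell whose four quarters each lie in a single cell of the
   other mesh, [P l m], [U l m] and [V l m] being the polynomials there. *)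
Lemma new_average_ge0 (k : nat) (g t : seq R) (w0 : R) (I J : R * R)
    (dx dy theta dt ax ay hbar bbar : R) (h u v b : R * R -> R)
    (P U V : bool -> bool -> {poly {poly R}}) :
  quad_pair k g t w0 ->
  0 < dx -> 0 < dy -> I.2 - I.1 = dx -> J.2 - J.1 = dy ->
  0 < dt -> 0 <= theta <= 1 -> 0 <= hbar ->
  bbar = (dx * dy)^-1 * box_int I J b ->
  (forall l m, [/\ total_degree_le k (P l m), total_degree_le k (U l m) &
    total_degree_le k (V l m)]) ->
  (forall l m z, half_itv I l z.1 -> half_itv J m z.2 -> h z = peval (P l m) z) ->
  (forall l m z, box (half_of I l) (half_of J m) z ->
    [/\ u z = peval (U l m) z, v z = peval (V l m) z,
        `|u z| <= ax & `|v z| <= ay]) ->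
  (forall l m z,
    ((nodes_on g (half_of I l) `*` nodes_on t (half_of J m)) `|`
     (nodes_on t (half_of I l) `*` nodes_on g (half_of J m))) z ->
    0 <= peval (P l m) z) ->
  dt / dx * ax + dt / dy * ay <= 4^-1 * theta * w0 ->
  0 <= new_average theta dt dx dy I J hbar bbar h u v b.
Proof.
move=> gt_pair dx0 dy0 Idx Jdy dt0 /andP[th0 th1] hbar0 -> deg hP uv P0 cfl.
have I12 : I.1 <= I.2 by rewrite -subr_ge0 Idx ltW.
have J12 : J.1 <= J.2 by rewrite -subr_ge0 Jdy ltW.
pose FX l m := pint (half_of J m).1 (half_of J m).2
  ((P l m).[(edge I l)%:P] * (U l m).[(edge I l)%:P]).
pose FY l m := pint (half_of I l).1 (half_of I l).2
  (slice (P l m) (edge J m) * slice (V l m) (edge J m)).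
(* [X] and [Y] stand for the fluxes with either sign, since opposite edges enter the update with
   opposite signs. *)
have quarter l m (X Y : R) : X <= `|FX l m| -> Y <= `|FY l m| ->
    dt * X + dt * Y <= theta * dint (half_of I l) (half_of J m) (P l m).
  move=> hX hY; rewrite -mulrDr.
  apply: (@le_trans _ _ (dt * (`|FX l m| + `|FY l m|))).
    by rewrite ler_pM2l // lerD.
  have [Pk Uk Vk] := deg l m.
  have eE (K : R * R) e : edge K e = edge (half_of K e) e by case: e.
  rewrite /FX /FY (eE I) (eE J); apply: (@quarter_ge R k g t w0 gt_pair _ _ _ _ _ _ _
    l m dx dy theta dt ax ay) => //.
  - exact: half_of_le.
  - exact: half_of_le.
  - exact: P0.
  - by rewrite /half_of; case: (l) => /=; lra.
  - by rewrite /half_of; case: (m) => /=; lra.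
  - by move=> z /uv[<-].
  - by move=> z /uv[_ <-].
(* Each end of the cell belongs to the half next to it, so the traces in the flux integrals are
   those of the polynomials of the adjacent quarters. *)
have inI l : half_itv I l (edge I l).
  by rewrite /half_itv /side_itv /half_of; case: l => /=; rewrite in_itv /=; lra.
have inJ m : half_itv J m (edge J m).
  by rewrite /half_itv /side_itv /half_of; case: m => /=; rewrite in_itv /=; lra.
have half_sub K l r : half_itv K l r -> `[(half_of K l).1, (half_of K l).2]%classic r.
  exact: side_itvS.
have hE l m s r : half_itv I l s -> half_itv J m r ->
    [/\ h (s, r) = peval (P l m) (s, r), u (s, r) = peval (U l m) (s, r) &
        v (s, r) = peval (V l m) (s, r)].
  move=> Is Jr; have [|uE vE _ _] := uv l m (s, r).
    by split; exact: half_sub.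
  by rewrite (hP l m).
rewrite /new_average subrr mulr0 addr0 (box_int_pw_poly _ _ _ P) //.
rewrite (@Rintegral_pw_poly _ J _ (fun m =>
  (P true m).[(edge I true)%:P] * (U true m).[(edge I true)%:P] -
  (P false m).[(edge I false)%:P] * (U false m).[(edge I false)%:P])) //; last first.
  move=> m r Jt; rewrite hornerD hornerN !hornerM.
  have [-> -> _] := hE true m _ _ (inI true) Jt.
  by have [-> -> _] := hE false m _ _ (inI false) Jt.
rewrite (@Rintegral_pw_poly _ I _ (fun l =>
  slice (P l true) (edge J true) * slice (V l true) (edge J true) -
  slice (P l false) (edge J false) * slice (V l false) (edge J false))) //; last first.
  move=> l r It; rewrite hornerD hornerN !hornerM.
  have [-> _ ->] := hE l true _ _ It (inJ true).
  by have [-> _ ->] := hE l false _ _ It (inJ false); rewrite !peval_slice.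
rewrite !big_bool !pintB -/(FX true true) -/(FX true false) -/(FX false true)
  -/(FX false false) -/(FY true true) -/(FY true false) -/(FY false true)
  -/(FY false false).
have N1 (X : R) : - X <= `|X| by rewrite -normrN ler_norm.
have := quarter true true _ _ (ler_norm _) (ler_norm _).
have := quarter true false _ _ (ler_norm _) (N1 _).
have := quarter false true _ _ (N1 _) (ler_norm _).
have := quarter false false _ _ (N1 _) (N1 _).
have i0 : 0 <= (dx * dy)^-1 by rewrite invr_ge0 mulr_ge0 ?ltW.
move: (dint _ _ _) (dint _ _ _) (dint _ _ _) (dint _ _ _) => D1 D2 D3 D4.
move: (FX _ _) (FX _ _) (FX _ _) (FX _ _) (FY _ _) (FY _ _) (FY _ _) (FY _ _).
move=> X1 X2 X3 X4 Y1 Y2 Y3 Y4 q1 q2 q3 q4.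
have h0 : 0 <= (1 - theta) * hbar by rewrite mulr_ge0 // subr_ge0.
set w := (_ * _)^-1 in i0 *.
(* The update is a multiple of the old average plus the sum, over the quarters, of theta times the
   integral minus the fluxes. *)
rewrite /= (_ : _ - _ = (1 - theta) * hbar + w * (theta * (D1 + D2 + (D3 + D4)) -
  dt * (X1 - X3 + (X2 - X4)) - dt * (Y1 - Y2 + (Y3 - Y4)))); last ring.
rewrite addr_ge0 // mulr_ge0 //; lra.
Qed.

End NewAverage.

(** * Geometry of the overlapping meshes *)

Section Meshes.
Context {R : realType}.
Implicit Types (x : int -> R) (I J : R * R).

Lemma uniform_partitionE x dx i : uniform_partition x dx ->
  x i = x 0 + i%:~R * dx.
Proof.
move=> [_ xS]; have xN (m : nat) : x m = x 0 + m%:R * dx.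
  elim: m => [|m IH]; first by rewrite mul0r addr0.
  by have := xS m; rewrite -PoszD addn1 IH -natr1; lra.
case: i => m; first by rewrite xN.
rewrite NegzE mulrNz -pmulrn; elim: m => [|m IH].
  by have := xS (- 1%:Z); rewrite addNr; lra.
have := xS (- m.+2%:Z); rewrite (_ : - m.+2%:Z + 1 = - m.+1%:Z) ?IH; last by lia.
by rewrite -[m.+2%:R]natr1; lra.
Qed.

Lemma cell_indexE (c : int -> R * R) d i t : 0 < d -> (c 0).2 - (c 0).1 = d ->
  (c i).1 = (c 0).1 + i%:~R * d -> (c i).1 <= t < (c i).1 + d ->
  cell_index c t = i.
Proof.
move=> d0 cd -> /andP[ti tS]; apply: floor_def; rewrite cd intrD.
by rewrite ler_pdivlMr // ltr_pdivrMr //; apply/andP; split; lra.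
Qed.

Section Partition.
Variables (x : int -> R) (dx : R).
Hypothesis hx : uniform_partition x dx.

Let dx0 : 0 < dx. Proof. by case: hx. Qed.

Lemma mid_pred i : mid x (i - 1) = x i - dx / 2.
Proof. by case: hx => _ /(_ (i - 1)); rewrite /mid subrK; lra. Qed.

Lemma mid_partition i : mid x i = x i + dx / 2.
Proof. by case: hx => _ /(_ i); rewrite /mid; lra. Qed.

Lemma partition_pred i : x (i - 1) = x i - dx.
Proof. by case: hx => _ /(_ (i - 1)); rewrite subrK; lra. Qed.

Lemma partition_succ i : x (i + 1) = x i + dx.
Proof. by case: hx => _ /(_ i); lra. Qed.

Lemma primal_length i : (primal x i).2 - (primal x i).1 = dx.
Proof. by rewrite /= mid_pred mid_partition; lra. Qed.

Lemma dual_length i : (dual x i).2 - (dual x i).1 = dx.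
Proof. by rewrite /= partition_pred; lra. Qed.

Lemma half_of_primal i l : half_of (primal x i) l = Defs.half x l i.
Proof.
by rewrite /half_of /Defs.half /= mid_pred mid_partition; case: l; congr (_, _); lra.
Qed.

(** Left halves of dual cells are right halves of primal cells and conversely, whence the
    negations. *)
Lemma half_of_dual i l : half_of (dual x i) l = Defs.half x (~~ l) (i - (~~ l)%:Z).
Proof. by rewrite /half_of /Defs.half; case: l; rewrite /= ?subr0 /mid ?subrK. Qed.

Lemma cell_index_primal i t : (primal x i).1 <= t < (primal x i).2 ->
  cell_index (primal x) t = i.
Proof.
move=> ti; apply: (@cell_indexE _ dx) => //; first exact: primal_length.
  change (mid x (i - 1) = mid x (0 - 1) + i%:~R * dx).
  by rewrite !mid_pred (uniform_partitionE _ _ i hx); lra.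
by rewrite -(primal_length i) subrKC.
Qed.

Lemma cell_index_dual i t : (dual x i).1 <= t < (dual x i).2 ->
  cell_index (dual x) t = i.
Proof.
move=> ti; apply: (@cell_indexE _ dx) => //; first exact: dual_length.
  change (x (i - 1) = x (0 - 1) + i%:~R * dx).
  by rewrite !partition_pred (uniform_partitionE _ _ i hx); lra.
by rewrite -(dual_length i) subrKC.
Qed.

(** The half-open halves agree with the floor in [cell_index]: the right end that is kept lies
    strictly inside a cell of the other mesh. *)
Lemma half_itv_primal i l t : half_itv (primal x i) l t ->
  cell_index (dual x) t = i + l%:Z.
Proof.
rewrite /half_itv half_of_primal /side_itv /Defs.half => H; apply: cell_index_dual.
move: H; case: l => /=; rewrite in_itv /= ?addrK ?addr0.
  have -> : x (i + 1%Z) = x i + dx := partition_succ i.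
  by rewrite mid_partition; have := dx0; lra.
rewrite mid_pred partition_pred; have := dx0; lra.
Qed.

Lemma half_itv_dual i l t : half_itv (dual x i) l t ->
  cell_index (primal x) t = i - (~~ l)%:Z.
Proof.
rewrite /half_itv half_of_dual /side_itv /Defs.half => H; apply: cell_index_primal.
move: H; case: l => /=; rewrite in_itv /= ?subr0 ?mid_pred ?mid_partition ?partition_pred;
  have := dx0; lra.
Qed.

Lemma half_of_primal_sub i l t :
  (half_of (primal x i) l).1 <= t <= (half_of (primal x i) l).2 ->
  (dual x (i + l%:Z)).1 <= t <= (dual x (i + l%:Z)).2.
Proof.
rewrite half_of_primal /Defs.half; case: l => /=; rewrite ?addrK ?addr0.
  have -> : x (i + 1%Z) = x i + dx := partition_succ i.
  by rewrite mid_partition; have := dx0; lra.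
by rewrite mid_pred partition_pred; have := dx0; lra.
Qed.

Lemma half_of_dual_sub i l t :
  (half_of (dual x i) l).1 <= t <= (half_of (dual x i) l).2 ->
  (primal x (i - (~~ l)%:Z)).1 <= t <= (primal x (i - (~~ l)%:Z)).2.
Proof.
rewrite half_of_dual /Defs.half; case: l => /=;
  rewrite ?subr0 ?mid_pred ?mid_partition ?partition_pred; have := dx0; lra.
Qed.

End Partition.

(** An infinite norm with a positive coefficient would make the left side infinite, so the CFL
    condition itself forces bounded velocities. *)
Lemma cfl_fin (a b c : R) (A B : \bar R) : 0 < a -> 0 < b ->
  (0 <= A)%E -> (0 <= B)%E -> (a%:E * A + b%:E * B <= c%:E)%E ->
  exists ax ay, [/\ A = ax%:E, B = ay%:E & a * ax + b * ay <= c].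
Proof.
move=> a0 b0; case: A => [ax| |] // _; case: B => [ay| |] // _.
- by rewrite -!EFinM -EFinD lee_fin => H; exists ax, ay.
- by rewrite gt0_muley ?lte_fin // -EFinM addey // leye_eq.
- by rewrite gt0_muley ?lte_fin // -EFinM addye // leye_eq.
- by rewrite !gt0_muley ?lte_fin // addye // leye_eq.
Qed.

Lemma sup_norm_ubound (A : set (R * R)) u z : A z -> (`|u z|%:E <= sup_norm A u)%E.
Proof. by move=> Az; apply: ereal_sup_ubound; exists z. Qed.

(* [fi l] and [gj m] index the cell of the other mesh that contains the
   quarter [(l, m)]. *)
Lemma new_average_pw_ge0 (cx cy : int -> R * R) (IX : set (int * int))
    (k : nat) (g t : seq R) (w0 : R) (I J : R * R) (fi gj : bool -> int)
    (dx dy theta dt hbar bbar : R) (p : pieces R) (u v b : R * R -> R)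
    (A B : \bar R) :
  quad_pair k g t w0 ->
  0 < dx -> 0 < dy -> I.2 - I.1 = dx -> J.2 - J.1 = dy ->
  0 < dt -> 0 <= theta <= 1 -> 0 <= hbar ->
  bbar = (dx * dy)^-1 * box_int I J b ->
  (forall l s, half_itv I l s -> cell_index cx s = fi l) ->
  (forall m s, half_itv J m s -> cell_index cy s = gj m) ->
  (forall l s, (half_of I l).1 <= s <= (half_of I l).2 ->
    (cx (fi l)).1 <= s <= (cx (fi l)).2) ->
  (forall m s, (half_of J m).1 <= s <= (half_of J m).2 ->
    (cy (gj m)).1 <= s <= (cy (gj m)).2) ->
  (forall l m, IX (fi l, gj m)) ->
  pieces_le k IX p -> cont_pw_poly k cx cy IX u -> cont_pw_poly k cx cy IX v ->
  (forall l m z,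
    ((nodes_on g (half_of I l) `*` nodes_on t (half_of J m)) `|`
     (nodes_on t (half_of I l) `*` nodes_on g (half_of J m))) z ->
    0 <= peval (p (fi l) (gj m)) z) ->
  (sup_norm (region cx cy IX) u <= A)%E -> (sup_norm (region cx cy IX) v <= B)%E ->
  ((dt / dx)%:E * A + (dt / dy)%:E * B <= (4^-1 * theta * w0)%:E)%E ->
  0 <= new_average theta dt dx dy I J hbar bbar (pw cx cy p) u v b.
Proof.
move=> gt_pair dx0 dy0 Idx Jdy dt0 th hbar0 bE ixI ixJ subI subJ IXlm pk [_ uk] [_ vk].
move=> p0 uA vB cfl.
have inbox l m z : box (half_of I l) (half_of J m) z -> box (cx (fi l)) (cy (gj m)) z.
  by move=> [/= zI zJ]; split => /=; move: zI zJ; rewrite !in_itv /= => zI zJ;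
    [exact: subI|exact: subJ].
have inreg l m z : box (half_of I l) (half_of J m) z -> region cx cy IX z.
  by move=> /inbox zb; exists (fi l, gj m).
have uA' l m z : box (half_of I l) (half_of J m) z -> (`|u z|%:E <= A)%E.
  by move=> /inreg zb; apply: le_trans uA; exact: sup_norm_ubound.
have vB' l m z : box (half_of I l) (half_of J m) z -> (`|v z|%:E <= B)%E.
  by move=> /inreg zb; apply: le_trans vB; exact: sup_norm_ubound.
(* A sample point shows that the bounds [A] and [B] are nonnegative; the supremum over an empty set
   would be -oo. *)
have corner : box (half_of I false) (half_of J false) (I.1, J.1).
  by split; rewrite /= in_itv /=; lra.
have A0 : (0 <= A)%E by apply: le_trans (uA' _ _ _ corner); rewrite lee_fin.
have B0 : (0 <= B)%E by apply: le_trans (vB' _ _ _ corner); rewrite lee_fin.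
have [ax [ay [AE BE {}cfl]]] :=
  cfl_fin _ _ _ _ _ (divr_gt0 dt0 dx0) (divr_gt0 dt0 dy0) A0 B0 cfl.
have /choice[U HU] (lm : bool * bool) : exists W : {poly {poly R}},
    total_degree_le k W /\
    (forall z, box (cx (fi lm.1)) (cy (gj lm.2)) z -> u z = peval W z).
  by have [W W1 W2] := uk _ _ (IXlm lm.1 lm.2); exists W.
have /choice[V HV] (lm : bool * bool) : exists W : {poly {poly R}},
    total_degree_le k W /\
    (forall z, box (cx (fi lm.1)) (cy (gj lm.2)) z -> v z = peval W z).
  by have [W W1 W2] := vk _ _ (IXlm lm.1 lm.2); exists W.
apply: (@new_average_ge0 R k g t w0 I J dx dy theta dt ax ay hbar bbar _ u v b
  (fun l m => p (fi l) (gj m)) (fun l m => U (l, m)) (fun l m => V (l, m))) => //.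
- move=> l m; split; first exact: pk.
  + by have [] := HU (l, m).
  + by have [] := HV (l, m).
- by move=> l m z /ixI zI /ixJ zJ; rewrite /pw zI zJ.
- move=> l m z zb; have [_ uE] := HU (l, m); have [_ vE] := HV (l, m).
  split; [exact/uE/inbox|exact/vE/inbox| |].
  + by have := uA' l m z zb; rewrite AE lee_fin.
  + by have := vB' l m z zb; rewrite BE lee_fin.
Qed.

End Meshes.

(** * Nonnegativity of the new averages on both meshes *)

Theorem proposition3p3 (R : realType)
  (* meshes *)
  (x y : int -> R) (dx dy : R)
  (hx : uniform_partition x dx) (hy : uniform_partition y dy)
  (IC ID : set (int * int))
  (* discrete functions *)
  (k : nat) (hk : (1 <= k)%N)
  (hC hD : nat -> pieces R) (uC uD vC vD : nat -> R * R -> R)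
  (bC bD : pieces R)
  (hbarC hbarD : nat -> int -> int -> R) (bbarC bbarD : int -> int -> R)
  (dt : nat -> R) (tau theta : R)
  (* quadrature *)
  (N Nh : nat) (hNh2 : (2 <= Nh)%N) (hNh : (k <= 2 * Nh - 3)%N)
  (hN : quad_exact (gauss_nodes R N) (2 * k + 1))
  (n : nat)
  (hdt : 0 < dt n) (htau : 0 < tau)
  (htheta : theta = dt n / tau) (htheta01 : 0 <= theta <= 1)
  (hhC : pieces_le k IC (hC n)) (hhD : pieces_le k ID (hD n))
  (hbC : pieces_le k IC bC) (hbD : pieces_le k ID bD)
  (huC : cont_pw_poly k (primal x) (primal y) IC (uC n))
  (hvC : cont_pw_poly k (primal x) (primal y) IC (vC n))
  (huD : cont_pw_poly k (dual x) (dual y) ID (uD n))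
  (hvD : cont_pw_poly k (dual x) (dual y) ID (vD n))
  (* cell averages at time t_n *)
  (havgC : forall i j, IC (i, j) -> hbarC n i j =
     box_avg (primal x i) (primal y j) (pw (primal x) (primal y) (hC n)))
  (havgD : forall i j, ID (i, j) -> hbarD n i j =
     box_avg (dual x i) (dual y j) (pw (dual x) (dual y) (hD n)))
  (havgbC : forall i j, IC (i, j) -> bbarC i j =
     box_avg (primal x i) (primal y j) (pw (primal x) (primal y) bC))
  (havgbD : forall i j, ID (i, j) -> bbarD i j =
     box_avg (dual x i) (dual y j) (pw (dual x) (dual y) bD))
  (hbar0C : forall i j, IC (i, j) -> 0 <= hbarC n i j)
  (hbar0D : forall i j, ID (i, j) -> 0 <= hbarD n i j)
  (* the scheme *)
  (hnewC : forall i j, stencilC IC ID i j -> hbarC n.+1 i j =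
     new_average theta (dt n) dx dy (primal x i) (primal y j)
       (hbarC n i j) (bbarC i j)
       (pw (dual x) (dual y) (hD n)) (uD n) (vD n)
       (pw (dual x) (dual y) bD))
  (hnewD : forall i j, stencilD IC ID i j -> hbarD n.+1 i j =
     new_average theta (dt n) dx dy (dual x i) (dual y j)
       (hbarD n i j) (bbarD i j)
       (pw (primal x) (primal y) (hC n)) (uC n) (vC n)
       (pw (primal x) (primal y) bC))
  (* compatibility of the bottom averages *)
  (hbbarC : forall i j, stencilC IC ID i j -> bbarC i j =
     (dx * dy)^-1 * box_int (primal x i) (primal y j) (pw (dual x) (dual y) bD))
  (hbbarD : forall i j, stencilD IC ID i j -> bbarD i j =
     (dx * dy)^-1 * box_int (dual x i) (dual y j) (pw (primal x) (primal y) bC))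
  (* nonnegativity at the quadrature points of each quarter *)
  (hpos : forall (i j : int) (l m : bool) (z : R * R),
     IC (i, j) -> ID (i + l%:Z, j + m%:Z) ->
     quad_points N Nh x y l m i j z ->
     0 <= peval (hC n i j) z /\ 0 <= peval (hD n (i + l%:Z) (j + m%:Z)) z)
  (* CFL condition *)
  (hCFL :
     let ax := maxe (sup_norm (region (primal x) (primal y) IC) (uC n))
                    (sup_norm (region (dual x) (dual y) ID) (uD n)) in
     let ay := maxe (sup_norm (region (primal x) (primal y) IC) (vC n))
                    (sup_norm (region (dual x) (dual y) ID) (vD n)) in
     ((dt n / dx)%:E * ax + (dt n / dy)%:E * ay
        <= (4^-1 * theta * lobatto_end_weight R Nh)%:E)%E) :
  (forall i j, stencilC IC ID i j -> 0 <= hbarC n.+1 i j) /\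
  (forall i j, stencilD IC ID i j -> 0 <= hbarD n.+1 i j).
Proof.
have gl := gauss_lobatto_quad_pair _ _ _ hNh2 hNh hN.
have dx0 : 0 < dx by case: hx.
have dy0 : 0 < dy by case: hy.
have hx1 := primal_length _ _ hx; have hy1 := primal_length _ _ hy.
have hx2 := dual_length _ _ hx; have hy2 := dual_length _ _ hy.
split => i j st; have [ij nb] := st.
- rewrite hnewC //.
  apply: (@new_average_pw_ge0 R (dual x) (dual y) ID k _ _ _ _ _
    (fun l => i + l%:Z) (fun m => j + m%:Z) _ _ _ _ _ _ _ _ _ _ _ _ gl
    dx0 dy0 (hx1 i) (hy1 j) hdt htheta01 (hbar0C _ _ ij) (hbbarC _ _ st)
    (half_itv_primal _ _ hx i) (half_itv_primal _ _ hy j)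
    (half_of_primal_sub _ _ hx i) (half_of_primal_sub _ _ hy j)
    nb hhD huD hvD _ _ _ hCFL).
  + move=> l m z; rewrite (half_of_primal _ _ hx) (half_of_primal _ _ hy) => zL.
    by have [] := hpos i j l m z ij (nb l m) zL.
  + by rewrite le_max lexx orbT.
  + by rewrite le_max lexx orbT.
- rewrite hnewD //.
  apply: (@new_average_pw_ge0 R (primal x) (primal y) IC k _ _ _ _ _
    (fun l => i - (~~ l)%:Z) (fun m => j - (~~ m)%:Z) _ _ _ _ _ _ _ _ _ _ _ _ gl
    dx0 dy0 (hx2 i) (hy2 j) hdt htheta01 (hbar0D _ _ ij) (hbbarD _ _ st)
    (half_itv_dual _ _ hx i) (half_itv_dual _ _ hy j)
    (half_of_dual_sub _ _ hx i) (half_of_dual_sub _ _ hy j)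
    (fun l m => nb (~~ l) (~~ m)) hhC huC hvC _ _ _ hCFL).
  + move=> l m z; rewrite !half_of_dual => zL.
    (* Quadrature points are indexed by primal cells: quarter [(l, m)] of the dual cell is quarter
       [(~~ l, ~~ m)] of the primal cell containing it. *)
    have [] := hpos (i - (~~ l)%:Z) (j - (~~ m)%:Z) (~~ l) (~~ m) z _ _ zL => //.
    by rewrite !subrK.
  + by rewrite le_max lexx.
  + by rewrite le_max lexx.
Qed.
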